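(* There is a polynomial-time algorithm that, given a $(4,N)$-weakly stable instance of Minimum Multiway Cut with integer edge weights in the range $[1,\mathrm{poly}(n)]$ ($n$ the number of vertices), returns a multiway cut belonging to $N$. (The set $N$ is not part of the input and is not known to the algorithm.)
   Context: Minimum Multiway Cut: given a graph $G=(V,E,w)$ with positive edge weights and terminals $s_1,\dots,s_k$, a multiway cut is a partition $S_1,\dots,S_k$ of $V$ with $s_i\in S_i$; its cost is the total weight of edges with endpoints in different parts. Let $\mathcal S^*$ be a minimum multiway cut, $N$ a set of multiway cuts containing $\mathcal S^*$, and $\gamma\ge1$. $G$ is a $(\gamma,N)$-weakly stable instance if for every multiway cut $\mathcal S'\notin N$: $w(E'\setminus E^* )>\gamma\,w(E^*\setminus E')$, where $E^*$ and $E'$ are the sets of edges cut by $\mathcal S^*$ and $\mathcal S'$ (equivalently, $w'(E')>w'(E^* )$ for every $w'$ with $w\le w'\le\gamma w$). *)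

(* Defs.v *)
From HB Require Import structures.
From mathcomp Require Import all_boot all_order all_algebra.

Set Implicit Arguments.
Unset Strict Implicit.
Unset Printing Implicit Defensive.

Import Order.TTheory GRing.Theory Num.Theory.

(* A textbook unit-cost RAM (Cook and Reckhow; Papadimitriou, Computational
   Complexity, Section 2.6): countably many registers holding natural numbers,
   direct and indirect addressing, addition and truncated subtraction, and
   no multiplication. A step lengthens the largest register content by at most
   one bit beyond the constants of the program, so this model is polynomially
   equivalent to Turing machines when the size of the input is its bit length. *)
Inductive instr : Type :=
| Const of nat & nat        (* Const i c : R[i] <- c             *)
| Add of nat & nat & nat    (* Add i j l : R[i] <- R[j] + R[l]   *)
| Sub of nat & nat & nat    (* Sub i j l : R[i] <- R[j] - R[l]   *)
| Fetch of nat & nat        (* Fetch i j : R[i] <- R[R[j]]       *)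
| Store of nat & nat        (* Store i j : R[R[i]] <- R[j]       *)
| Jump of nat               (* Jump a    : goto a                *)
| Jzero of nat & nat.       (* Jzero i a : if R[i] = 0 goto a    *)

Definition program := seq instr.

Record config := Config { pc : nat; reg : nat -> nat }.

Definition upd (m : nat -> nat) (i x : nat) : nat -> nat :=
  fun j => if j == i then x else m j.

Definition exec (a : instr) (c : config) : config :=
  let: Config l m := c in
  match a with
  | Const i x => Config l.+1 (upd m i x)
  | Add i j h => Config l.+1 (upd m i (m j + m h))
  | Sub i j h => Config l.+1 (upd m i (m j - m h))
  | Fetch i j => Config l.+1 (upd m i (m (m j)))
  | Store i j => Config l.+1 (upd m (m i) (m j))
  | Jump b => Config b m
  | Jzero i b => Config (if m i == 0 then b else l.+1) m
  end.

(* The machine halts when the program counter leaves the program; a halted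
   configuration is a fixed point of [step]. *)
Definition halted (P : program) (c : config) : bool := size P <= pc c.

Definition step (P : program) (c : config) : config :=
  if onth P (pc c) is Some a then exec a c else c.

(* Input and output convention: the length of the list is in register 0 and its
   items are in registers 1, 2, and so on; the other registers are initially 0. *)
Definition init (x : seq nat) : config := Config 0 (nth 0 (size x :: x)).

Definition output (c : config) : seq nat := mkseq (fun i => reg c i.+1) (reg c 0).

Definition computes_within (P : program) (x : seq nat) (t : nat) (y : seq nat) :=
  let c := iter t (step P) (init x) in halted P c /\ output c = y.

Definition bitsize (x : seq nat) : nat := \sum_(a <- x) (trunc_log 2 a).+1.

Local Open Scope ring_scope.

(* [weight] is only meaningful on [edges]. *)
Record instance (R : realDomainType) (V : finType) (k : nat) := Instance {
  edges : {set {set V}};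
  edges_card : forall e, e \in edges -> #|e| = 2%N;
  weight : {set V} -> R;
  weight_gt0 : forall e, e \in edges -> 0 < weight e;
  terminal : 'I_k -> V;
  terminal_inj : injective terminal
}.

Section MultiwayCut.
Variables (R : realDomainType) (V : finType) (k : nat) (G : instance R V k).

Definition multiway_cut (S : {ffun 'I_k -> {set V}}) : bool :=
  [&& [forall i, terminal G i \in S i],
      [forall i, forall j, (i != j) ==> [disjoint S i & S j]]
    & \bigcup_i S i == [set: V]].

Definition cut_edges (S : {ffun 'I_k -> {set V}}) : {set {set V}} :=
  [set e in edges G | [exists i, exists j,
     [&& i != j, e :&: S i != set0 & e :&: S j != set0]]].

Definition total_weight (A : {set {set V}}) : R := \sum_(e in A) weight G e.

Definition min_multiway_cut (S : {ffun 'I_k -> {set V}}) : Prop :=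
  multiway_cut S /\
  forall S', multiway_cut S' ->
    total_weight (cut_edges S) <= total_weight (cut_edges S').

Definition weakly_stable (gamma : R) (N : {set {ffun 'I_k -> {set V}}}) : Prop :=
  (forall S, S \in N -> multiway_cut S) /\
  exists Sopt, [/\ min_multiway_cut Sopt, Sopt \in N &
    forall S', multiway_cut S' -> S' \notin N ->
      gamma * total_weight (cut_edges Sopt :\: cut_edges S')
        < total_weight (cut_edges S' :\: cut_edges Sopt)].

End MultiwayCut.

(* The vertices are 0, ..., n - 1. The list is n, k, the k terminals, then the
   n * n weighted adjacency matrix row by row, where 0 stands for the absence of
   an edge. *)
Definition encode_instance (n k : nat) (G : instance int 'I_n k) : seq nat :=
  [:: n; k] ++ [seq val (terminal G i) | i <- enum 'I_k]
  ++ [seq if [set u; v] \in edges G then `|weight G [set u; v]|%N else 0%N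
     | u <- enum 'I_n, v <- enum 'I_n].

(* For each vertex v in order, the index i in {0, ..., k - 1} with v in S_i. *)
Definition encode_cut (n k : nat) (S : {ffun 'I_k -> {set 'I_n}}) : seq nat :=
  [seq find (fun i => v \in S i) (enum 'I_k) | v <- enum 'I_n].

(* Main.v *)
(* The algorithm is local search with expansion moves: for a label a, replace the
   current labelling f by the cheapest labelling obtained from it by giving the
   label a to a set of vertices, which is a minimum s-t cut in an auxiliary network.
   If f is a local optimum and g is the minimum multiway cut, compare f with the
   labellings that agree with g on g^-1(a) and with f elsewhere, and sum over a:
   this gives w(E_f \ E_g) <= 2 w(E_g \ E_f), which (4, N)-weak stability forbids
   unless f lies in N. The weights are integers, so every improving move lowers the
   cost by at least 1; as they are polynomially bounded, so are the number of moves
   and the number of unit augmentations that compute each minimum cut. An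
   augmentation lowers the residual weight of every s-t cut by exactly 1, so the set
   reached by a search that finds no sink, whose residual weight is 0, is a minimum
   cut, and no maximum flow theory is needed.

   The algorithm is a program of a small language in which all loops are counted,
   compiled to the register machine. Loop bounds are read from variables that the
   loop bodies do not change, so the running time can be bounded from the syntax of
   the program and a bound on these variables. *)

Require Import Defs.
From HB Require Import structures.
From mathcomp Require Import all_boot all_order all_algebra.
From mathcomp Require Import zify.

Set Implicit Arguments.
Unset Strict Implicit.
Unset Printing Implicit Defensive.

Import Order.TTheory GRing.Theory Num.Theory.

(** * Structured code for the register machine *)

(** [P] is chosen before [p], so the program cannot know the polynomial. It computes its own
    iteration bound, one more than the sum of the matrix entries, which exceeds the cost of every
    labelling; [p] enters only when this bound is estimated by the bit size. The latter rests on a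
    dichotomy for a single move with label [a]. The cost of [f] is the weight of a minimum cut plus
    the residual weight of the cut formed by the vertices that [f] labels [a]. If this residual
    weight is 0, the last search reaches no other vertex and the move does nothing; otherwise the
    move is a strict improvement. Sums range over ordered pairs, so all weights occur doubled, which
    keeps the network integral although it splits edges into halves. The input has unknown length
    and sits in the low registers, where the compiled code keeps its variables; hence the
    relocations around that code. *)

Inductive raw : Type :=
| Ins of instr
| RSeq of raw & raw
| RIf of nat & raw & raw
| RWhile of nat & raw.

Definition effect (a : instr) (m : nat -> nat) : nat -> nat :=
  reg (exec a (Config 0 m)).

Definition is_jump (a : instr) : bool :=
  if a is (Jump _ | Jzero _ _) then true else false.

(** The step counts are exact: a nonzero test also pays for the jump over the other branch, or back
    to the head of the loop, and a zero test only for itself. *)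
Inductive run : raw -> (nat -> nat) -> nat -> (nat -> nat) -> Prop :=
| run_ins a m : ~~ is_jump a -> run (Ins a) m 1 (effect a m)
| run_seq a b m t m1 u m2 :
    run a m t m1 -> run b m1 u m2 -> run (RSeq a b) m (t + u) m2
| run_ifT r a b m t m1 :
    m r != 0 -> run a m t m1 -> run (RIf r a b) m t.+2 m1
| run_ifF r a b m t m1 :
    m r = 0 -> run b m t m1 -> run (RIf r a b) m t.+1 m1
| run_while0 r a m : m r = 0 -> run (RWhile r a) m 1 m
| run_whileS r a m t m1 u m2 :
    m r != 0 -> run a m t m1 -> run (RWhile r a) m1 u m2 ->
    run (RWhile r a) m (t.+2 + u) m2.

Fixpoint raw_size (c : raw) : nat :=
  match c with
  | Ins _ => 1
  | RSeq a b => raw_size a + raw_size b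
  | RIf _ a b => (raw_size a + raw_size b).+2
  | RWhile _ a => (raw_size a).+2
  end.

Fixpoint code (l : nat) (c : raw) : program :=
  match c with
  | Ins a => [:: a]
  | RSeq a b => code l a ++ code (l + raw_size a) b
  | RIf r a b =>
      Jzero r (l + raw_size a).+2 ::
      code l.+1 a ++ Jump (l + raw_size a + raw_size b).+2 ::
      code (l + raw_size a).+2 b
  | RWhile r a => Jzero r (l + raw_size a).+2 :: code l.+1 a ++ [:: Jump l]
  end.

Lemma size_code l c : size (code l c) = raw_size c.
Proof.
elim: c l => //= [a iha b ihb|r a iha b ihb|r a iha] l.
- by rewrite size_cat iha ihb.
- by rewrite size_cat /= iha ihb addnS.
- by rewrite size_cat /= iha addn1.
Qed.

Definition code_at (P : program) (l : nat) (q : program) : Prop :=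
  forall i, i < size q -> onth P (l + i) = onth q i.

Lemma code_at_cat P l q r :
  code_at P l (q ++ r) -> code_at P l q /\ code_at P (l + size q) r.
Proof.
move=> h; split=> i hi.
  by rewrite h ?size_cat ?ltn_addr // onth_cat hi.
by rewrite -addnA h ?size_cat ?ltn_add2l // onth_cat ltnNge leq_addr /= addKn.
Qed.

Lemma code_at_cons P l a q :
  code_at P l (a :: q) -> onth P l = Some a /\ code_at P l.+1 q.
Proof.
move=> h; split; first by have := h 0 isT; rewrite addn0.
by move=> i hi; rewrite addSnnS h.
Qed.

(** Induction on the derivation of [run], not on the code: the last premise of [run_whileS] concerns
    the same loop at the same address. *)
Lemma run_code P c m t m1 : run c m t m1 -> forall l, code_at P l (code l c) ->
  iter t (step P) (Config l m) = Config (l + raw_size c) m1.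
Proof.
elim=> {c m t m1} [a m ja|a b m t m1 u m2 _ iha _ ihb|r a b m t m1 nz _ iha
  |r a b m t m1 z _ ihb|r a m z|r a m t m1 u m2 nz _ iha _ ihw] l;
  cbn [code raw_size].
- move=> /code_at_cons[h _]; rewrite /= /step /= h addn1 /effect.
  by case: a ja {h}.
- move=> /code_at_cat[ha hb]; rewrite addnC iterD (iha _ ha).
  by rewrite size_code in hb; rewrite ihb ?addnA.
- move=> /code_at_cons[h /code_at_cat[ha /code_at_cons[hj _]]].
  rewrite iterSr {2}/step /= h /= (negbTE nz) iha //.
  rewrite size_code in hj.
  by rewrite /step [pc _]/= hj /= !addnS addnA.
- move=> /code_at_cons[h /code_at_cat[_ /code_at_cons[_ hb]]].
  rewrite iterSr {2}/step /= h /= z eqxx ihb; last first.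
    by move: hb; rewrite size_code !addSn.
  by rewrite !addnS !addSn addnA.
- by move=> /code_at_cons[h _]; rewrite /step /= h /= z !addnS.
- move=> hc; have /code_at_cons[h /code_at_cat[ha /code_at_cons[hj _]]] := hc.
  have -> : (t.+2 + u = u + t.+2)%N by rewrite addnC.
  rewrite iterD iterSr {3}/step /= h /= (negbTE nz) iha //.
  by rewrite size_code in hj; rewrite {2}/step [pc _]/= hj /= ihw //.
Qed.

(** * A language with counted loops *)

Inductive expr : Type :=
| Num of nat
| Var of nat
| Plus of expr & expr
| Minus of expr & expr
| At of nat & expr.

Inductive stmt : Type :=
| Skip
| Assign of nat & expr
| Put of nat & expr & expr
| Seq of stmt & stmt
| If of expr & stmt & stmt
| For of nat & nat & stmt.

Record state := State { var : nat -> nat; arr : nat -> nat -> nat }.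

Definition setv (s : state) (x a : nat) : state := State (upd (var s) x a) (arr s).

Definition seta (s : state) (a i v : nat) : state :=
  State (var s) (fun b => if b == a then upd (arr s a) i v else arr s b).

Fixpoint eval (e : expr) (s : state) : nat :=
  match e with
  | Num c => c
  | Var x => var s x
  | Plus a b => eval a s + eval b s
  | Minus a b => eval a s - eval b s
  | At a e => arr s a (eval e s)
  end.

(** The recursion peels off the last iteration, so [loop i f s j] is the state before iteration [j],
    with counter [j], and invariants are proved upwards in [j]. *)
Fixpoint loop (i : nat) (f : state -> state) (s : state) (N : nat) : state :=
  if N is N'.+1 then setv (f (loop i f s N')) i N else setv s i 0.

Fixpoint sem (c : stmt) (s : state) : state :=
  match c with
  | Skip => s
  | Assign x e => setv s x (eval e s)
  | Put a e1 e2 => seta s a (eval e1 s) (eval e2 s)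
  | Seq a b => sem b (sem a s)
  | If e a b => if eval e s != 0 then sem a s else sem b s
  | For i x b => loop i (sem b) s (var s x)
  end.

(* Variable x < 16 is register x, registers 16 to 31 are temporaries, and the arrays
   a < 8 are interleaved, so that they never overlap and need no bound. *)
Definition cell (a i : nat) : nat := 32 + a + 8 * i.

Definition rseq (l : seq instr) (c : raw) : raw :=
  foldr (fun a c => RSeq (Ins a) c) c l.

(** Three doublings and an addition turn the index in register [t] into the address of its cell.
    Register 31 is scratch, hence the bound 31 in [wf_expr]. *)
Definition to_cell (t a : nat) (c : raw) : raw :=
  rseq [:: Add t t t; Add t t t; Add t t t; Const 31 (32 + a); Add t t 31] c.

Fixpoint raw_expr (t : nat) (e : expr) : raw :=
  match e with
  | Num c => Ins (Const t c)
  | Var x => RSeq (Ins (Const t 0)) (Ins (Add t x t))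
  | Plus a b => RSeq (raw_expr t a) (RSeq (raw_expr t.+1 b) (Ins (Add t t t.+1)))
  | Minus a b => RSeq (raw_expr t a) (RSeq (raw_expr t.+1 b) (Ins (Defs.Sub t t t.+1)))
  | At a e => RSeq (raw_expr t e) (to_cell t a (Ins (Fetch t t)))
  end.

Fixpoint expr_cost (e : expr) : nat :=
  match e with
  | Num c => 1
  | Var x => 2
  | Plus a b | Minus a b => expr_cost a + (expr_cost b + 1)
  | At a e => expr_cost e + 6
  end.

Fixpoint wf_expr (t : nat) (e : expr) : bool :=
  match e with
  | Num c => t < 31
  | Var x => (t < 31) && (x < 16)
  | Plus a b | Minus a b => wf_expr t a && wf_expr t.+1 b
  | At a e => wf_expr t e && (a < 8)
  end.

Fixpoint raw_stmt (c : stmt) : raw :=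
  match c with
  | Skip => Ins (Const 31 0)
  | Assign x e =>
      RSeq (raw_expr 16 e) (rseq [:: Const 31 0] (Ins (Add x 16 31)))
  | Put a e1 e2 =>
      RSeq (raw_expr 16 e1) (RSeq (raw_expr 17 e2) (to_cell 16 a (Ins (Store 16 17))))
  | Seq a b => RSeq (raw_stmt a) (raw_stmt b)
  | If e a b => RSeq (raw_expr 16 e) (RIf 16 (raw_stmt a) (raw_stmt b))
  | For i x b =>
      rseq [:: Const i 0; Defs.Sub 31 x i]
        (RWhile 31 (RSeq (raw_stmt b)
          (rseq [:: Const 31 1; Add i i 31] (Ins (Defs.Sub 31 x i)))))
  end.

Fixpoint cost (c : stmt) (s : state) : nat :=
  match c with
  | Skip => 1
  | Assign x e => expr_cost e + 2
  | Put a e1 e2 => expr_cost e1 + (expr_cost e2 + 6)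
  | Seq a b => cost a s + cost b (sem a s)
  | If e a b =>
      expr_cost e + (if eval e s != 0 then (cost a s).+2 else (cost b s).+1)
  | For i x b =>
      (* 3 pays for the two instructions before the loop and the final test; 5 pays for the test,
         the jump back and the three instructions that advance the counter. *)
      3 + \sum_(0 <= j < var s x) (cost b (loop i (sem b) s j) + 5)
  end.

Fixpoint wvars (c : stmt) : seq nat :=
  match c with
  | Skip | Put _ _ _ => [::]
  | Assign x _ => [:: x]
  | Seq a b | If _ a b => wvars a ++ wvars b
  | For i _ b => i :: wvars b
  end.

Fixpoint warrs (c : stmt) : seq nat :=
  match c with
  | Skip | Assign _ _ => [::]
  | Put a _ _ => [:: a]
  | Seq a b | If _ a b => warrs a ++ warrs b
  | For _ _ b => warrs b
  end.

Fixpoint wf (c : stmt) : bool :=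
  match c with
  | Skip => true
  | Assign x e => (x < 16) && wf_expr 16 e
  | Put a e1 e2 => [&& a < 8, wf_expr 16 e1 & wf_expr 17 e2]
  | Seq a b => wf a && wf b
  | If e a b => [&& wf_expr 16 e, wf a & wf b]
  | For i x b =>
      [&& i < 16, x < 16, i != x, i \notin wvars b, x \notin wvars b & wf b]
  end.

Definition frame (c : stmt) (s s' : state) : Prop :=
  (forall x, x \notin wvars c -> var s' x = var s x) /\
  (forall a, a \notin warrs c -> arr s' a = arr s a).

Lemma frame_loop i x b s N : (forall s, frame b s (sem b s)) ->
  frame (For i x b) s (loop i (sem b) s N).
Proof.
move=> hb; elim: N => [|N [ihv iha]]; split=> y //= hy.
- by rewrite /upd; case: eqP hy => // ->; rewrite inE eqxx.
- have [h _] := hb (loop i (sem b) s N).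
  move: (hy); rewrite inE negb_or => /andP[/negbTE yi yb].
  by rewrite /upd yi h // ihv.
- by have [_ h] := hb (loop i (sem b) s N); rewrite h // iha.
Qed.

Lemma frame_sem c s : frame c s (sem c s).
Proof.
elim: c s => [|x e|a e1 e2|a iha b ihb|e a iha b ihb|i x b ihb] s; try by split.
- split=> //= y; rewrite inE /upd => /negbTE -> //.
- split=> //= y; rewrite inE => /negbTE -> //.
- have [va aa] := iha s; have [vb ab] := ihb (sem a s).
  by split=> y; rewrite /= mem_cat negb_or => /andP[ha hb]; rewrite ?vb ?va ?ab ?aa.
- have [va aa] := iha s; have [vb ab] := ihb s.
  split=> y; rewrite /= mem_cat negb_or => /andP[ha hb];
    case: ifP => _; by rewrite ?vb ?va ?ab ?aa.
- by apply: frame_loop.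
Qed.

(** * Correctness of the compilation *)

Definition represents (s : state) (m : nat -> nat) : Prop :=
  (forall x, x < 16 -> m x = var s x) /\
  (forall a i, a < 8 -> m (cell a i) = arr s a i).

(** With [t = 16], only temporaries have changed, so [represents] survives; a larger [t] also
    protects the values of pending subexpressions. *)
Definition agree_below (t : nat) (m m1 : nat -> nat) : Prop :=
  forall r, r < t \/ 32 <= r -> m1 r = m r.

Lemma agree_belowW t u m m1 : t <= u -> agree_below u m m1 -> agree_below t m m1.
Proof. by move=> tu h r hr; apply: h; lia. Qed.

Lemma agree_below_trans t m m1 m2 :
  agree_below t m m1 -> agree_below t m1 m2 -> agree_below t m m2.
Proof. by move=> h1 h2 r hr; rewrite h2 // h1. Qed.

Lemma agree_below_upd t m r v : t <= r < 32 -> agree_below t m (upd m r v).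
Proof. by move=> h q hq; rewrite /upd; case: eqP => // ?; lia. Qed.

Lemma represents_agree s m m1 :
  agree_below 16 m m1 -> represents s m -> represents s m1.
Proof.
move=> h [hv ha]; split=> [x hx|a i ai]; first by rewrite h ?hv //; left.
by rewrite h ?ha //; right; rewrite /cell; lia.
Qed.

Lemma run_rseq l c m t m1 : all (predC is_jump) l ->
  run c (foldl (fun m a => effect a m) m l) t m1 ->
  run (rseq l c) m (size l + t) m1.
Proof.
elim: l m => [|a l ih] m //= /andP[ja jl] h.
by rewrite addSn -add1n; apply: run_seq; [apply: run_ins | apply: ih].
Qed.

Lemma wf_expr_lt t e : wf_expr t e -> t < 31.
Proof.
by elim: e => //= [x /andP[]|a iha b _ /andP[/iha]|a iha b _ /andP[/iha]
  |a e ihe /andP[/ihe]].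
Qed.

(** The temporaries from [t] on serve as a stack: the second operand is evaluated from [t.+1] on,
    which preserves the first one in register [t]. *)
Lemma run_expr e : forall t s m, 16 <= t -> wf_expr t e -> represents s m ->
  exists2 m1, run (raw_expr t e) m (expr_cost e) m1 &
    m1 t = eval e s /\ agree_below t m m1.
Proof.
elim: e => [c|x|a iha b ihb|a iha b ihb|a e ihe] t s m ht /=.
- move=> t31 _; exists (effect (Const t c) m); first exact: run_ins.
  by split; [rewrite /effect /= /upd eqxx | apply: agree_below_upd; lia].
- move=> /andP[t31 x16] [hv _].
  exists (effect (Add t x t) (effect (Const t 0) m)).
    by apply: (@run_seq _ _ _ 1 _ 1); apply: run_ins.
  rewrite /effect /= /upd eqxx; split.
    by case: eqP => [?|_]; [lia | rewrite addn0 hv].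
  by move=> r hr; rewrite /upd; case: eqP => // ?; lia.
- move=> /andP[wa wb] hr.
  have [m1 r1 [e1 a1]] := iha _ _ _ ht wa hr.
  have hr1 := represents_agree (agree_belowW ht a1) hr.
  have [m2 r2 [e2 a2]] := ihb t.+1 _ _ (leqW ht) wb hr1.
  exists (effect (Add t t t.+1) m2).
    by apply: (run_seq r1); apply: (run_seq r2); apply: run_ins.
  have t32 : t < 32.
    exact: ltnW (wf_expr_lt wa).
  split; first by rewrite /effect /= /upd eqxx e2 a2 ?e1 //; left.
  apply: (agree_below_trans a1); apply: (agree_below_trans (agree_belowW (leqnSn t) a2)).
  by apply: agree_below_upd; rewrite leqnn.
- move=> /andP[wa wb] hr.
  have [m1 r1 [e1 a1]] := iha _ _ _ ht wa hr.
  have hr1 := represents_agree (agree_belowW ht a1) hr.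
  have [m2 r2 [e2 a2]] := ihb t.+1 _ _ (leqW ht) wb hr1.
  exists (effect (Defs.Sub t t t.+1) m2).
    by apply: (run_seq r1); apply: (run_seq r2); apply: run_ins.
  have t32 : t < 32.
    exact: ltnW (wf_expr_lt wa).
  split; first by rewrite /effect /= /upd eqxx e2 a2 ?e1 //; left.
  apply: (agree_below_trans a1); apply: (agree_below_trans (agree_belowW (leqnSn t) a2)).
  by apply: agree_below_upd; rewrite leqnn.
- move=> /andP[we a8] hr; have t31 := wf_expr_lt we.
  have [m1 r1 [e1 a1]] := ihe _ _ _ ht we hr.
  have hr1 := represents_agree (agree_belowW ht a1) hr.
  eexists.
    by apply: (run_seq r1); apply: (@run_rseq _ _ _ 1) => //; apply: run_ins.
  have tn : (t == 31) = false by lia.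
  have tn' : (31 == t) = false by lia.
  rewrite /effect /= /upd /= !eqxx ?tn ?tn' /= e1; split.
    have [_ h] := hr1; rewrite -(h a) //.
    have -> : cell a (eval e s) = eval e s + eval e s + (eval e s + eval e s) +
      (eval e s + eval e s + (eval e s + eval e s)) + (32 + a) by rewrite /cell; lia.
    by do 2 (case: eqP => [?|_]; first lia).
  apply: (agree_below_trans a1) => r hrr.
  by do !(case: eqP => [?|_]; first lia).
Qed.

Lemma represents_setv s m x v : x < 16 -> represents s m ->
  represents (setv s x v) (upd m x v).
Proof.
move=> hx [hv ha]; split=> [y hy|a i ai] /=; rewrite /upd.
  by case: eqP => // _; apply: hv.
by rewrite -ha //; case: eqP => // e; rewrite /cell in e; lia.
Qed.

Lemma cell_inj a b i j : a < 8 -> b < 8 -> cell a i = cell b j -> a = b /\ i = j.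
Proof. by rewrite /cell; lia. Qed.

Lemma represents_seta s m a i v : a < 8 -> represents s m ->
  represents (seta s a i v) (upd m (cell a i) v).
Proof.
move=> a8 [hv ha]; split=> [y hy|b j b8] /=; rewrite /upd.
  by rewrite -hv //; case: eqP => // e; rewrite /cell in e; lia.
case: (b =P a) => [->|nab].
  case: (j =P i) => [->|nij]; rewrite ?eqxx //.
  by rewrite -ha //; case: eqP => // /cell_inj[].
by rewrite -ha //; case: eqP => // /cell_inj[].
Qed.

Lemma represents_tmp s m r v : 16 <= r < 32 -> represents s m -> represents s (upd m r v).
Proof. by move=> hr; apply: represents_agree; apply: agree_below_upd. Qed.

Lemma run_stmt c : forall s m, wf c -> represents s m ->
  exists2 m1, run (raw_stmt c) m (cost c s) m1 & represents (sem c s) m1.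
Proof.
elim: c => [|x e|a e1 e2|a iha b ihb|e a iha b ihb|i x b ihb] s m.
- move=> _ hr; exists (effect (Const 31 0) m); first exact: run_ins.
  exact: represents_tmp.
- move=> /andP[x16 we] hr.
  have [m1 r1 [e1 a1]] := run_expr (leqnn 16) we hr.
  have hr1 := represents_agree a1 hr.
  exists (upd (upd m1 31 0) x (eval e s)).
    apply: (run_seq r1); apply: (@run_rseq _ _ _ 1) => //.
    have -> : upd (upd m1 31 0) x (eval e s) =
              effect (Add x 16 31) (effect (Const 31 0) m1).
      by rewrite /effect /= /upd /= e1 addn0.
    exact: run_ins.
  by apply: represents_setv => //; apply: represents_tmp.
- move=> /and3P[a8 w1 w2] hr.
  have [m1 r1 [v1 a1]] := run_expr (leqnn 16) w1 hr.
  have hr1 := represents_agree a1 hr.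
  have [m2 r2 [v2 a2]] := run_expr (isT : 16 <= 17) w2 hr1.
  have hr2 := represents_agree (agree_belowW (isT : 16 <= 17) a2) hr1.
  eexists.
    apply: (run_seq r1); apply: (run_seq r2).
    by apply: (@run_rseq _ _ _ 1) => //; apply: run_ins.
  set m3 := foldl _ _ _.
  have h16 : m3 16 = cell a (eval e1 s).
    by rewrite /m3 /effect /= /upd /= a2 ?v1; [rewrite /cell; lia | left].
  have h17 : m3 17 = eval e2 s by rewrite -v2.
  have hr3 : represents s m3 by do 5 (apply: represents_tmp => //).
  by rewrite /effect /= h16 h17; apply: represents_seta.
- move=> /andP[wa wb] hr.
  have [m1 r1 hr1] := iha _ _ wa hr; have [m2 r2 hr2] := ihb _ _ wb hr1.
  by exists m2 => //; apply: run_seq r1 r2.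
- move=> /and3P[we wa wb] hr.
  have [m1 r1 [e1 a1]] := run_expr (leqnn 16) we hr.
  have hr1 := represents_agree a1 hr.
  cbn [sem cost raw_stmt].
  case: ifP => hz.
    have [m2 r2 hr2] := iha _ _ wa hr1; exists m2 => //.
    by apply: (run_seq r1); apply: run_ifT; rewrite ?e1.
  have [m2 r2 hr2] := ihb _ _ wb hr1; exists m2 => //.
  by apply: (run_seq r1); apply: run_ifF => //; rewrite e1; apply/eqP/negbFE.
- move=> /and5P[i16 x16 ix inb /andP[xnb wb]] hr.
  cbn [sem cost raw_stmt].
  set N := var s x; set F := loop i (sem b) s.
  have Fx j : var (F j) x = N.
    elim: j => [|j ih] /=; rewrite /upd eq_sym (negbTE ix) //.
    by have [-> //] := frame_sem b (F j).
  have Fi j : var (F j) i = j by case: j => [|j] /=; rewrite /upd eqxx.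
  (* Induction on the number [d] of iterations still to be made, which is the content of register 31
     at each test. *)
  have itr d : forall j m, j + d = N -> represents (F j) m -> m 31 = d ->
    exists2 m1, run (RWhile 31 (RSeq (raw_stmt b)
          (rseq [:: Const 31 1; Add i i 31] (Ins (Defs.Sub 31 x i))))) m
          (1 + \sum_(j <= l < N) (cost b (F l) + 5)) m1 & represents (F N) m1.
    elim: d => [|d ih] j m0 hj hr0 h31.
      rewrite addn0 in hj; rewrite hj big_geq // addn0 in hr0 *.
      by exists m0; [apply: run_while0|].
    have [m1 r1 hr1] := ihb _ _ wb hr0.
    pose m2 := upd (upd (upd m1 31 1) i j.+1) 31 d.
    have [fv _] := frame_sem b (F j).
    have hr2 : represents (F j.+1) m2.
      apply: represents_tmp => //; apply: (represents_setv _ i16).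
      exact: represents_tmp.
    have [m3 r3 hr3] := ih j.+1 m2 ltac:(lia) hr2 erefl.
    exists m3 => //; rewrite big_ltn; last by lia.
    have e6 c S : 1 + (c + 5 + S) = (c + 3).+2 + (1 + S) by lia.
    rewrite e6.
    apply: (run_whileS _ _ r3); first by rewrite h31.
    apply: (run_seq r1); apply: (@run_rseq _ _ _ 1) => //.
    have n31 : (31 == i) = false by lia.
    have x31 : (x == 31) = false by lia.
    have i31 : (i == 31) = false by lia.
    have [hv1 _] := hr1.
    suff -> : m2 = effect (Defs.Sub 31 x i) (foldl (fun m a => effect a m) m1
                     [:: Const 31 1; Add i i 31]) by apply: run_ins.
    rewrite /= /effect /= /m2 /upd !eqxx i31 x31 eq_sym (negbTE ix) !hv1 //.
    by rewrite !fv // Fx Fi addn1 -hj addnS -addSn addKn.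
  pose m1 := upd (upd m i 0) 31 N.
  have hr1 : represents (F 0) m1.
    by apply: represents_tmp => //; apply: represents_setv.
  have [m2 r2 hr2] := itr N 0 m1 erefl hr1 erefl.
  exists m2 => //.
  have [hv _] := hr.
  suff e : m1 = foldl (fun m a => effect a m) m [:: Const i 0; Defs.Sub 31 x i].
    by rewrite -[3]/(2 + 1) -addnA; apply: run_rseq => //; rewrite -e.
  rewrite /= /effect /= /m1 /upd eqxx eq_sym (negbTE ix) subn0 hv //.
Qed.

(** * Running times read off the syntax *)

Fixpoint keeps (ro : seq nat) (c : stmt) : bool :=
  match c with
  | Skip | Put _ _ _ => true
  | Assign x _ => x \notin ro
  | Seq a b | If _ a b => keeps ro a && keeps ro b
  | For i x b => [&& i \notin ro, x \in ro & keeps ro b]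
  end.

Lemma keeps_sem ro c s x : keeps ro c -> x \in ro -> var (sem c s) x = var s x.
Proof.
move=> k hx; have [-> //] := frame_sem c s.
elim: c k {s} => //= [y e|a iha b ihb|e a iha b ihb|i y b ihb].
- by rewrite inE; apply: contra => /eqP <-.
- by move=> /andP[/iha ha /ihb hb]; rewrite mem_cat negb_or ha.
- by move=> /andP[/iha ha /ihb hb]; rewrite mem_cat negb_or ha.
- move=> /and3P[hi _ /ihb hb]; rewrite inE negb_or hb andbT.
  by apply: contraNneq hi => <-.
Qed.

(* B bounds all loop counts; T is nat or {poly nat}, the latter to produce the
   polynomial of the theorem. *)
Fixpoint time_bound (T : nzSemiRingType) (c : stmt) (B : T) : T :=
  (match c with
  | Skip => 1
  | Assign x e => (expr_cost e + 2)%:R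
  | Put a e1 e2 => (expr_cost e1 + (expr_cost e2 + 6))%:R
  | Seq a b => time_bound a B + time_bound b B
  | If e a b => (expr_cost e + 2)%:R + (time_bound a B + time_bound b B)
  | For i x b => 3%:R + B * (time_bound b B + 5%:R)
  end)%R.

(** All loop bounds belong to [ro], which no statement writes, so they keep their initial values in
    every intermediate state and the single number [B] bounds every loop at every depth. *)
Lemma cost_le ro c s B : keeps ro c ->
  (forall x, x \in ro -> var s x <= B) -> cost c s <= time_bound c B.
Proof.
elim: c s => [|x e|a e1 e2|a iha b ihb|e a iha b ihb|i x b ihb] s /=.
- by [].
- by rewrite natn.
- by rewrite natn.
- move=> /andP[ka kb] h; apply: leq_add; first exact: iha.
  by apply: ihb => // x hx; rewrite (keeps_sem _ ka) // h.
- move=> /andP[ka kb] h; rewrite natn.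
  have := iha s ka h; have := ihb s kb h.
  by rewrite /GRing.add /=; case: ifP => _; lia.
- move=> /and3P[hi hx kb] h; rewrite !natn; apply: (@leq_add 3 _ 3) => //.
  apply: (@leq_trans (\sum_(0 <= j < var s x) (time_bound b B + 5))).
    apply: leq_sum => j _; rewrite leq_add2r; apply: ihb => // y hy.
    have kl : var (loop i (sem b) s j) y = var s y.
      elim: j => [|j ih] /=; rewrite /upd; case: eqP => [yi|_] //.
      + by rewrite -yi hy in hi.
      + by rewrite -yi hy in hi.
      by rewrite (keeps_sem _ kb).
    by rewrite kl h.
  by rewrite sum_nat_const_nat subn0; apply: leq_mul => //; apply: h.
Qed.

(** [time_bound] uses only semiring operations, which commute with evaluation. *)
Lemma horner_time_bound c (B : {poly nat}) n :
  (time_bound c B).[n]%R = time_bound c (B.[n])%R.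
Proof.
have nat_poly k : ((k%:R : {poly nat}).[n])%R = k%:R%R by rewrite -polyC_natr hornerC.
elim: c => [|x e|a e1 e2|a iha b ihb|e a iha b ihb|i x b ihb];
  cbn [time_bound]; rewrite ?hornerE ?nat_poly ?iha ?ihb //.
Qed.

(** * Input and output *)

(** The items are moved in descending order: item [j] goes to register [32 + 8 * j], above every
    item not yet read. The loop stops before items 1 to 4 because registers 1 to 4 are at work in
    it. *)
Definition load_loop : raw :=
  RWhile 3 (rseq [:: Add 3 2 2; Add 3 3 3; Add 3 3 3; Const 4 32; Add 4 4 3; Fetch 3 2;
                     Store 4 3; Defs.Sub 2 2 1; Const 3 4] (Ins (Defs.Sub 3 2 3))).

(* Moves item j of the input, found in register j, to item j of array 0. The
   input occupies an unknown initial segment of the registers, so registers 1 to 4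
   are first saved above 64 times the input length, an address that is computed
   inside register 0; the length is then recovered by repeated subtraction. *)
Definition load : raw :=
  rseq (nseq 6 (Add 0 0 0))
  (rseq [:: Store 0 1; Const 1 1; Add 0 0 1; Store 0 2; Add 0 0 1; Store 0 3;
            Add 0 0 1; Store 0 4; Const 2 0; Const 3 3; Defs.Sub 3 0 3; Const 4 64]
  (RSeq (RWhile 3 (rseq [:: Defs.Sub 3 3 4] (Ins (Add 2 2 1))))
  (rseq [:: Const 3 4; Defs.Sub 3 2 3]
  (RSeq load_loop
  (rseq [:: Fetch 3 0; Const 4 (cell 0 4); Store 4 3; Defs.Sub 0 0 1;
            Fetch 3 0; Const 4 (cell 0 3); Store 4 3; Defs.Sub 0 0 1;
            Fetch 3 0; Const 4 (cell 0 2); Store 4 3; Defs.Sub 0 0 1;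
            Fetch 3 0; Const 4 (cell 0 1)] (Ins (Store 4 3))))))).

(** The block begins at register [39 + 8 * n], beyond the destinations 0 to [n], so no item is
    overwritten before it is read; this is why the output starts at index [n] of array 7 and not at
    0. Items 0 to 4 are left to the end of [unload], since registers 0 to 4 are at work here. *)
Definition unload_loop : raw :=
  RWhile 3 (rseq [:: Add 3 2 2; Add 3 3 3; Add 3 3 3; Add 4 0 3; Fetch 3 4;
                     Store 2 3; Defs.Sub 2 2 1; Const 3 4] (Ins (Defs.Sub 3 2 3))).

(* With n the content of variable 5, moves items n to 2n of array 7 to the
   registers 0 to n. *)
Definition unload : raw :=
  rseq [:: Const 0 39; Add 3 5 5; Add 3 3 3; Add 3 3 3; Add 0 0 3;
           Const 2 0; Add 2 2 5; Const 1 1; Const 3 4; Defs.Sub 3 2 3]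
  (RSeq unload_loop
  (rseq [:: Const 4 32; Add 4 4 0; Fetch 4 4; Const 3 24; Add 3 3 0; Fetch 3 3;
            Const 2 16; Add 2 2 0; Fetch 2 2; Const 1 8; Add 1 1 0; Fetch 1 1]
    (Ins (Fetch 0 0)))).

Lemma run_cons a l c m m' t m1 : ~~ is_jump a -> m' = effect a m ->
  run (rseq l c) m' t m1 -> run (rseq (a :: l) c) m t.+1 m1.
Proof. by move=> ja -> h; rewrite -add1n; apply: run_seq h; apply: run_ins. Qed.

Lemma run_last a m m' : ~~ is_jump a -> m' = effect a m -> run (rseq [::] (Ins a)) m 1 m'.
Proof. by move=> ja ->; apply: run_ins. Qed.

Ltac known_cells :=
  repeat match goal with H : ?f ?r = _ |- context [?f ?r] => is_var f; rewrite H end.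

Ltac upd_cases :=
  repeat match goal with v := upd _ _ _ : _ |- _ => progress unfold v end;
  rewrite /upd /=; known_cells; repeat (case: eqP => ?; try lia; known_cells);
  try done; try lia.

Ltac instr_step mem := refine (@run_cons _ _ _ _ mem _ _ _ _ _);
  [by []|rewrite /effect /=; congr upd; upd_cases|].

Lemma run_load_length d : forall m e, m 1 = 1 -> m 2 = e -> m 3 = 64 * d -> m 4 = 64 ->
  exists2 m1, run (RWhile 3 (rseq [:: Defs.Sub 3 3 4] (Ins (Add 2 2 1)))) m (4 * d).+1 m1 &
    m1 2 = e + d /\ forall r, r != 2 -> r != 3 -> m1 r = m r.
Proof.
elim: d => [|d ih] m e m1 m2 m3 m4.
  by exists m; [apply: run_while0|rewrite addn0].
pose m' := upd (upd m 3 (64 * d)) 2 e.+1.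
have [//|//|//|//|m'' rr [h2 hr]] := ih m' e.+1.
exists m''.
  have -> : (4 * d.+1).+1 = 2.+2 + (4 * d).+1 by lia.
  apply: run_whileS rr; first by rewrite m3.
  instr_step (upd m 3 (64 * d)).
  by apply: run_last => //; rewrite /effect /=; congr upd; upd_cases.
split=> [|r n2 n3]; first by rewrite h2; lia.
by rewrite hr // /m' /upd (negbTE n2) (negbTE n3).
Qed.

(** The bound on [A] places the saved registers beyond all cells of the input. The last clause, that
    the cells of higher items are kept, serves the induction on [d]. *)
Lemma run_load_loop X L A d : forall j m, 40 + 8 * L < A -> d = j - 4 -> j <= L ->
  m 1 = 1 -> m 2 = j -> m 3 = d -> (forall i, 5 <= i <= j -> m i = X i) ->
  exists2 m1, run load_loop m (12 * d).+1 m1 &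
    [/\ m1 1 = 1, m1 0 = m 0, forall i, A <= i -> m1 i = m i,
        forall i, 5 <= i <= j -> m1 (cell 0 i) = X i &
        forall i, j < i <= L -> m1 (cell 0 i) = m (cell 0 i)].
Proof.
elim: d => [|d ih] j m hA hd jL m1 m2 m3 hX.
  exists m; first exact: run_while0.
  by split=> // i hi; lia.
pose v1 := upd m 3 (2 * j); pose v2 := upd v1 3 (4 * j); pose v3 := upd v2 3 (8 * j).
pose v4 := upd v3 4 32; pose v5 := upd v4 4 (cell 0 j); pose v6 := upd v5 3 (X j).
pose v7 := upd v6 (cell 0 j) (X j); pose v8 := upd v7 2 j.-1; pose v9 := upd v8 3 4.
pose m' := upd v9 3 d.
have cj : cell 0 j > 40 by rewrite /cell; lia.
have hXj := hX j ltac:(lia).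
have m'E r : 4 < r -> r != cell 0 j -> m' r = m r.
  move=> hr /eqP hrj.
  by upd_cases.
have hm' i : 5 <= i <= j.-1 -> m' i = X i.
  by move=> hi; rewrite m'E ?hX //; rewrite /cell; lia.
have [||||||m'' rr [h1 h0 hs h hL]] := ih j.-1 m' hA => //; try lia.
exists m''.
  have -> : (12 * d.+1).+1 = 10.+2 + (12 * d).+1 by lia.
  apply: run_whileS rr; first by rewrite m3.
  instr_step v1. instr_step v2. instr_step v3. instr_step v4.
  instr_step v5.
  instr_step v6. instr_step v7. instr_step v8. instr_step v9.
  by apply: run_last => //; rewrite /effect /=; congr upd; upd_cases.
split=> //.
- by move=> i hi; rewrite hs // m'E //; rewrite /cell; lia.
- move=> i hi; case: (ltnP i j) => hij; first by apply: h; lia.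
  have -> : i = j by lia.
  rewrite hL; last by lia.
  by upd_cases.
- by move=> i hi; rewrite hL ?m'E //; rewrite /cell; lia.
Qed.

Lemma run_load x : 2 <= size x ->
  exists t m, [/\ run load (nth 0 (size x :: x)) t m, t <= 16 * size x + 50 &
    forall j, 0 < j <= size x -> m (cell 0 j) = nth 0 (size x :: x) j].
Proof.
move=> L2; set X := nth 0 (size x :: x); set L := size x in L2 *.
pose A := 64 * L.
pose m1 := foldl (fun m a => effect a m) X (nseq 6 (Add 0 0 0)).
have m10 : m1 0 = A.
  rewrite /m1 /= /effect /= /upd /= /X /= /A -/L; lia.
have m1E r : r != 0 -> m1 r = X r.
  by move=> /negbTE hr; rewrite /m1 /= /effect /= /upd hr.
have m1n r : 0 < r -> m1 r = X r by move=> hr; rewrite m1E //; lia.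
have [m11 m12 m13 m14] : [/\ m1 1 = X 1, m1 2 = X 2, m1 3 = X 3 & m1 4 = X 4].
  by split; apply: m1E.
pose v1 := upd m1 A (X 1); pose v2 := upd v1 1 1; pose v3 := upd v2 0 (A + 1).
pose v4 := upd v3 (A + 1) (X 2); pose v5 := upd v4 0 (A + 2).
pose v6 := upd v5 (A + 2) (X 3); pose v7 := upd v6 0 (A + 3).
pose v8 := upd v7 (A + 3) (X 4); pose v9 := upd v8 2 0; pose v10 := upd v9 3 3.
pose v11 := upd v10 3 A; pose v12 := upd v11 4 64.
(* As the input has at least two items, the saved registers lie beyond 40, 48, 56 and 64, the cells
   of items 1 to 4, which are filled while saved items are still to be read. *)
have A128 : 128 <= A by rewrite /A; lia.
have [||||m2 r2 [h22 h2]] := @run_load_length L v12 0.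
- by upd_cases.
- by upd_cases.
- by [].
- by [].
pose v13 := upd m2 3 4; pose m3 := upd v13 3 (L - 4).
have m3E r : r != 2 -> r != 3 -> m3 r = v12 r.
  by move=> n2 n3; rewrite /m3 /v13 /upd (negbTE n3) h2.
have m31 : m3 1 = 1 by rewrite m3E //; upd_cases.
have hX i : 5 <= i <= L -> m3 i = X i.
  move=> hi; rewrite m3E; [|lia|lia]; rewrite -m1n; last lia.
  have hA : i < A by rewrite /A; lia.
  by upd_cases.
have LA : 40 + 8 * L < A by rewrite /A; lia.
have h32 : m3 2 = L by rewrite /m3 /v13 /upd /= h22.
have [m4 r4 [h41 h40 h4s h4 _]] :=
  run_load_loop LA erefl (leqnn L) m31 h32 erefl hX.
have m30 : m3 0 = A + 3 by rewrite m3E //; upd_cases.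
rewrite m30 in h40.
have st r : A <= r -> m4 r = v12 r.
  by move=> hr; rewrite h4s ?m3E //; lia.
have [s0 s1 s2 s3] : [/\ m4 A = X 1, m4 (A + 1) = X 2, m4 (A + 2) = X 3 & m4 (A + 3) = X 4].
  by split; rewrite st ?leq_addr //;
     upd_cases.
pose w1 := upd m4 3 (X 4); pose w2 := upd w1 4 64; pose w3 := upd w2 64 (X 4).
pose w4 := upd w3 0 (A + 2); pose w5 := upd w4 3 (X 3); pose w6 := upd w5 4 56.
pose w7 := upd w6 56 (X 3); pose w8 := upd w7 0 (A + 1); pose w9 := upd w8 3 (X 2).
pose w10 := upd w9 4 48; pose w11 := upd w10 48 (X 2); pose w12 := upd w11 0 A.
pose w13 := upd w12 3 (X 1); pose w14 := upd w13 4 40; pose w15 := upd w14 40 (X 1).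
exists (6 + (12 + ((4 * L).+1 + (2 + ((12 * (L - 4)).+1 + 15))))), w15; split.
- apply: run_rseq => //; rewrite -/m1.
  instr_step v1. instr_step v2. instr_step v3. instr_step v4. instr_step v5.
  instr_step v6. instr_step v7. instr_step v8. instr_step v9. instr_step v10.
  instr_step v11. instr_step v12.
  apply: (run_seq r2).
  instr_step v13. instr_step m3.
  apply: (run_seq r4).
  instr_step w1. instr_step w2. instr_step w3. instr_step w4.
  instr_step w5. instr_step w6. instr_step w7. instr_step w8.
  instr_step w9. instr_step w10. instr_step w11. instr_step w12.
  instr_step w13. instr_step w14.
  by apply: run_last => //; rewrite /effect /=; congr upd; upd_cases.
- lia.
- move=> j hj; case: (leqP 5 j) => j5.
    rewrite -h4; last lia.
    rewrite /cell.
    by upd_cases.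
  by case: j hj j5 => [|[|[|[|[|]]]]].
Qed.

Lemma run_unload_loop Y n d : forall j m, d = j - 4 -> j <= n ->
  m 0 = 39 + 8 * n -> m 1 = 1 -> m 2 = j -> m 3 = d ->
  (forall i, i <= n -> m (39 + 8 * n + 8 * i) = Y i) ->
  exists2 m1, run unload_loop m (11 * d).+1 m1 &
    [/\ m1 0 = 39 + 8 * n, forall i, i <= n -> m1 (39 + 8 * n + 8 * i) = Y i,
        forall i, 5 <= i <= j -> m1 i = Y i & forall i, j < i <= n -> 5 <= i -> m1 i = m i].
Proof.
elim: d => [|d ih] j m hd jn m0 m1 m2 m3 hY.
  exists m; first exact: run_while0.
  by split=> // i hi; lia.
pose v1 := upd m 3 (2 * j); pose v2 := upd v1 3 (4 * j); pose v3 := upd v2 3 (8 * j).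
pose v4 := upd v3 4 (39 + 8 * n + 8 * j); pose v5 := upd v4 3 (Y j).
pose v6 := upd v5 j (Y j); pose v7 := upd v6 2 j.-1; pose v8 := upd v7 3 4.
pose m' := upd v8 3 d.
have hYj := hY j jn.
have m'E r : 4 < r -> r != j -> m' r = m r.
  move=> hr /eqP hrj.
  by upd_cases.
have hm' i : i <= n -> m' (39 + 8 * n + 8 * i) = Y i.
  by move=> hi; rewrite m'E ?hY //; lia.
have [|||||||m'' rr [h0 h hj hn]] := ih j.-1 m' => //; try by upd_cases.
exists m''.
  have -> : (11 * d.+1).+1 = 9.+2 + (11 * d).+1 by lia.
  apply: run_whileS rr; first by rewrite m3.
  instr_step v1. instr_step v2. instr_step v3. instr_step v4.
  instr_step v5. instr_step v6. instr_step v7. instr_step v8.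
  by apply: run_last => //; rewrite /effect /=; congr upd; upd_cases.
split=> //.
- move=> i hi; case: (ltnP i j) => hij; first by apply: hj; lia.
  have -> : i = j by lia.
  rewrite hn; [|lia|lia].
  by upd_cases.
- by move=> i hi h5; rewrite hn ?m'E //; lia.
Qed.

Lemma run_unload s m n Y : represents s m -> var s 5 = n ->
  (forall i, i <= n -> arr s 7 (n + i) = Y i) ->
  exists t m1, [/\ run unload m t m1, t <= 16 * n + 50 & forall i, i <= n -> m1 i = Y i].
Proof.
move=> [hv ha] hn hY; have m5 : m 5 = n by rewrite hv.
have mY i : i <= n -> m (39 + 8 * n + 8 * i) = Y i.
  by move=> hi; rewrite -hY // -ha // /cell; congr m; lia.
pose v1 := upd m 0 39; pose v2 := upd v1 3 (2 * n); pose v3 := upd v2 3 (4 * n).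
pose v4 := upd v3 3 (8 * n); pose v5 := upd v4 0 (39 + 8 * n); pose v6 := upd v5 2 0.
pose v7 := upd v6 2 n; pose v8 := upd v7 1 1; pose v9 := upd v8 3 4.
pose m1 := upd v9 3 (n - 4).
have m1E r : 5 <= r -> m1 r = m r.
  move=> hr; by upd_cases.
have mY1 i : i <= n -> m1 (39 + 8 * n + 8 * i) = Y i.
  by move=> hi; rewrite m1E ?mY //; lia.
have [|||||m2 r2 [h0 h hj _]] := @run_unload_loop Y n (n - 4) n m1 erefl (leqnn n) => //;
  try by upd_cases.
pose w1 := upd m2 4 32; pose w2 := upd w1 4 (39 + 8 * n + 8 * 4).
pose w3 := upd w2 4 (m2 (39 + 8 * n + 8 * 4)).
pose w4 := upd w3 3 24; pose w5 := upd w4 3 (39 + 8 * n + 8 * 3).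
pose w6 := upd w5 3 (m2 (39 + 8 * n + 8 * 3)).
pose w7 := upd w6 2 16; pose w8 := upd w7 2 (39 + 8 * n + 8 * 2).
pose w9 := upd w8 2 (m2 (39 + 8 * n + 8 * 2)).
pose w10 := upd w9 1 8; pose w11 := upd w10 1 (39 + 8 * n + 8 * 1).
pose w12 := upd w11 1 (m2 (39 + 8 * n + 8 * 1)).
pose w13 := upd w12 0 (m2 (39 + 8 * n)).
have h00 : m2 (39 + 8 * n) = Y 0 by rewrite -h // muln0 addn0.
exists (10 + ((11 * (n - 4)).+1 + 13)), w13; split.
- instr_step v1. instr_step v2. instr_step v3. instr_step v4. instr_step v5.
  instr_step v6. instr_step v7. instr_step v8. instr_step v9. instr_step m1.
  apply: (run_seq r2).
  instr_step w1. instr_step w2. instr_step w3. instr_step w4.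
  instr_step w5. instr_step w6. instr_step w7. instr_step w8.
  instr_step w9. instr_step w10. instr_step w11. instr_step w12.
  by apply: run_last => //; rewrite /effect /=; congr upd; upd_cases.
- lia.
- move=> i hi; case: (leqP 5 i) => i5.
    rewrite -(hj i) ?i5 //.
    by upd_cases.
  by case: i hi i5 => [|[|[|[|[|]]]]] // hi _; apply: h.
Qed.

Definition compile (c : stmt) : program := code 0 (RSeq load (RSeq (raw_stmt c) unload)).

Definition reads_input (x : seq nat) (s : state) : Prop :=
  forall j, 0 < j <= size x -> arr s 0 j = nth 0 x j.-1.

(** After [load], the variables and the other arrays hold leftovers of the input, so the program has
    to work from every state that satisfies [reads_input]. The output is specified by a predicate
    because the returned cut is only known to belong to [N]. The constant 100 collects those of
    [load] and [unload]. *)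
Lemma compile_correct c x (P : seq nat -> Prop) n T t : wf c -> 2 <= size x ->
  (forall s, reads_input x s -> exists y,
     [/\ P y, size y = n, cost c s <= T, var (sem c s) 5 = n &
         forall i, i <= n -> arr (sem c s) 7 (n + i) = nth 0 (n :: y) i]) ->
  T + 16 * size x + 16 * n + 100 <= t ->
  exists2 y, P y & computes_within (compile c) x t y.
Proof.
move=> wfc x2 hc ht.
have [t1 [m1 [r1 le1 hx]]] := run_load x2.
pose s := State m1 (fun a i => m1 (cell a i)).
have hs : represents s m1 by split.
have hin : reads_input x s by move=> [|j] //= hj; rewrite hx.
have [y [hP szy costT v5 hy]] := hc s hin; exists y => //.
have [m2 r2 hr2] := run_stmt wfc hs.
have [t3 [m3 [r3 le3 hout]]] := run_unload hr2 v5 hy.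
have := run_code (run_seq r1 (run_seq r2 r3)) (P := compile c) (l := 0).
move=> /(_ (fun i _ => erefl)); rewrite add0n.
set t0 := t1 + _; set l := raw_size _ => hrun.
have le0 : t0 <= t by rewrite /t0; lia.
rewrite /computes_within /= -(subnK le0) iterD hrun.
have szP : size (compile c) = l by rewrite size_code.
have -> u : iter u (step (compile c)) (Config l m3) = Config l m3.
  by elim: u => //= u ->; rewrite /step [pc _]/= onth_default ?szP.
split; first by rewrite /halted szP.
rewrite /output /= hout //=.
apply: (@eq_from_nth _ 0); rewrite size_mkseq // => i hi.
by rewrite nth_mkseq // hout.
Qed.

(** * Labellings and local optimality *)

Section Labellings.
Variables (n k : nat) (w : 'I_n -> 'I_n -> nat) (term : 'I_k -> 'I_n).
Hypothesis w_sym : forall u v, w u v = w v u.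
Implicit Types (f g : 'I_n -> 'I_k) (a : 'I_k) (A : {set 'I_n}).

Definition pair_sum (F : 'I_n -> 'I_n -> nat) : nat := \sum_u \sum_v F u v.

Lemma eq_pair_sum F G : (forall u v, F u v = G u v) -> pair_sum F = pair_sum G.
Proof. by move=> h; apply: eq_bigr => u _; apply: eq_bigr. Qed.

Lemma leq_pair_sum F G : (forall u v, F u v <= G u v) -> pair_sum F <= pair_sum G.
Proof. by move=> h; apply: leq_sum => u _; apply: leq_sum. Qed.

Lemma pair_sumD F G : pair_sum F + pair_sum G = pair_sum (fun u v => F u v + G u v).
Proof. by rewrite -big_split; apply: eq_bigr => u _; rewrite -big_split. Qed.

Lemma pair_sumC F : pair_sum F = pair_sum (fun u v => F v u).
Proof. exact: exchange_big. Qed.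

Lemma pair_sumM c F : c * pair_sum F = pair_sum (fun u v => c * F u v).
Proof. by rewrite big_distrr; apply: eq_bigr => u _; rewrite big_distrr. Qed.

Lemma pair_sum_delta F x y :
  pair_sum (fun u v => F u v * ((u == x) && (v == y))) = F x y.
Proof.
rewrite /pair_sum (bigD1 x) //= (bigD1 y) //= !eqxx muln1 !big1 ?addn0 //.
  by move=> u /negbTE ux; rewrite big1 // => v _; rewrite ux muln0.
by move=> v /negbTE vy; rewrite vy andbF muln0.
Qed.

(* Every edge is counted once in each direction. *)
Definition labelling_cost f : nat := pair_sum (fun u v => (f u != f v) * w u v).

Definition cut_weight (c : 'I_n -> 'I_n -> nat) A : nat :=
  pair_sum (fun u v => ((u \in A) && (v \notin A)) * c u v).

Definition expand f a A : 'I_n -> 'I_k := fun u => if u \in A then a else f u.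

Definition expandable f a A : Prop :=
  (forall u, f u = a -> u \in A) /\ (forall i, i != a -> term i \notin A).

Definition split_pair f a u v : bool := [&& f u != a, f v != a & f u != f v].

(* The s-t cuts of this network, with the vertices labelled a as sources and the
   other terminals as sinks, are the expansions of a, at twice their weight: an
   edge whose ends carry two different labels other than a is free only if both of
   them are relabelled, which takes half of its capacity on the edge itself and
   half of it on an edge from the source to each of its ends. *)
Definition network f a u v : nat :=
  w u v + ~~ split_pair f a u v * w u v +
  (u == term a) * \sum_z split_pair f a v z * w v z.

(** An edge leaving [A] must count twice: once as itself, and once more either as itself or, when it
    is split, through the source edge of its outer end. Outside [A] no vertex is labelled [a], so
    there a pair is split exactly when [f] separates it, and the source edges account for it. *)
Lemma cut_network f a A : f (term a) = a -> expandable f a A ->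
  cut_weight (network f a) A = labelling_cost (expand f a A).
Proof.
move=> fa [hA _]; have tA := hA _ fa.
have fN u : u \notin A -> (f u == a) = false.
  by move=> hu; apply: contraNF hu => /eqP; apply: hA.
(* Since [term a] lies in [A], a source edge is cut exactly when its other end is outside [A]. *)
transitivity (pair_sum (fun u v => ((u \in A) && (v \notin A)) *
                                   (w u v + ~~ split_pair f a u v * w u v)) +
              pair_sum (fun u v => (u \notin A) * (split_pair f a u v * w u v))).
  rewrite /cut_weight /network.
  have -> : pair_sum (fun u v => (u \notin A) * (split_pair f a u v * w u v)) =
    pair_sum (fun u v => ((u \in A) && (v \notin A)) *
      ((u == term a) * \sum_z split_pair f a v z * w v z)).
    rewrite [RHS]pair_sumC; apply: eq_bigr => u _.
    rewrite [RHS](bigD1 (term a)) //= [X in _ + X]big1 ?addn0 => [|v /negbTE ->]; last first.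
      by rewrite muln0.
    by rewrite tA eqxx mul1n big_distrr.
  by rewrite pair_sumD; apply: eq_pair_sum => u v; rewrite -mulnDr.
pose b1 u v := ((u \notin A) && (v \in A)) * (split_pair f a u v * w u v).
pose b2 u v := ((u \notin A) && (v \notin A)) * (split_pair f a u v * w u v).
pose r1 u v := ((u \in A) && (v \notin A)) * w u v.
pose r2 u v := ((u \notin A) && (v \in A)) * w u v.
pose r3 u v := [&& u \notin A, v \notin A & f u != f v] * w u v.
have -> : pair_sum (fun u v => (u \notin A) * (split_pair f a u v * w u v)) =
    pair_sum (fun u v => b1 v u) + pair_sum b2.
  rewrite -(pair_sumC b1) pair_sumD; apply: eq_pair_sum => u v; rewrite /b1 /b2.
  by case: (u \in A); case: (v \in A); rewrite /= ?mul0n ?mul1n ?addn0.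
have -> : labelling_cost (expand f a A) =
    pair_sum r1 + pair_sum (fun u v => r2 v u) + pair_sum r3.
  rewrite -(pair_sumC r2) !pair_sumD; apply: eq_pair_sum => u v; rewrite /r1 /r2 /r3 /expand.
  case uA: (u \in A); case vA: (v \in A); rewrite /= ?eqxx ?mul0n ?mul1n ?addn0 //.
    by rewrite eq_sym fN ?vA // mul1n.
  by rewrite fN ?uA // mul1n.
rewrite addnA !pair_sumD; apply: eq_pair_sum => u v.
rewrite /b1 /b2 /r1 /r2 /r3 (w_sym v u).
have -> : split_pair f a v u = split_pair f a u v.
  by rewrite /split_pair andbCA (eq_sym (f v) (f u)).
case uA: (u \in A); case vA: (v \in A); rewrite /= ?mul0n ?mul1n ?addn0 //.
  by case: split_pair; rewrite /= ?mul0n ?mul1n; lia.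
by rewrite /split_pair !fN ?uA ?vA.
Qed.

Lemma expand_own f a : labelling_cost (expand f a [set u | f u == a]) = labelling_cost f.
Proof.
apply: eq_pair_sum => u v; rewrite /expand !inE.
by case: (f u =P a) => [->|_]; case: (f v =P a) => [->|_].
Qed.

Lemma cut_weight_eq0 (c : 'I_n -> 'I_n -> nat) A :
  cut_weight c A = 0 <-> forall u v, u \in A -> v \notin A -> c u v = 0.
Proof.
split=> [/eqP|h].
  rewrite sum_nat_eq0 => /forallP h u v uA vA; have := h u.
  by rewrite sum_nat_eq0 => /forallP/(_ v); rewrite uA vA mul1n => /eqP.
apply: big1 => u _; apply: big1 => v _.
by case uA: (u \in A); case vA: (v \in A); rewrite //= h ?uA ?vA.
Qed.

(** Only the positions of the two ends matter, and these terms telescope along a path: however often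
    a path from a vertex of [A] to one outside crosses the boundary, pushing a unit along it lowers
    the weight by 1 in total. *)
Lemma cut_weight_push (c c' : 'I_n -> 'I_n -> nat) x y A : x != y -> 0 < c x y ->
  (forall u v, c' u v = if (u == x) && (v == y) then (c u v).-1
                        else c u v + ((u == y) && (v == x))) ->
  cut_weight c' A + (x \in A) = cut_weight c A + (y \in A).
Proof.
move=> xy cxy hc.
pose chi u v := nat_of_bool ((u \in A) && (v \notin A)).
have : cut_weight c' A + chi x y = cut_weight c A + chi y x.
  rewrite -(pair_sum_delta chi x y) -(pair_sum_delta chi y x) !pair_sumD.
  apply: eq_pair_sum => u v; rewrite -!mulnDr hc; congr (_ * _).
  case: (boolP ((u == x) && (v == y))) => [/andP[/eqP -> /eqP ->]|_]; last by rewrite addn0.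
  by rewrite (negbTE xy) /=; lia.
by rewrite /chi; case: (x \in A); case: (y \in A); rewrite /=; lia.
Qed.

Definition locally_optimal f : Prop :=
  forall a A, expandable f a A -> labelling_cost f <= labelling_cost (expand f a A).

Definition respects f : Prop := forall i, f (term i) = i.

Definition separated_only f g : nat :=
  pair_sum (fun u v => ((f u != f v) && (g u == g v)) * w u v).

Lemma locally_optimal_le f g : respects f -> respects g -> locally_optimal f ->
  separated_only f g <= 2 * separated_only g f.
Proof.
move=> rf rg opt.
pose A a := [set u | (g u == a) || (f u == a)].
have hA a : expandable f a (A a).
  split=> [u <-|i ia]; first by rewrite inE eqxx orbT.
  by rewrite inE rf rg orbb.
have h1 : \sum_(a < k) labelling_cost f <= \sum_(a < k) labelling_cost (expand f a (A a)).
  by apply: leq_sum => a _; apply: opt.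
have sumP (F : 'I_k -> 'I_n -> 'I_n -> nat) :
    \sum_a pair_sum (F a) = pair_sum (fun u v => \sum_a F a u v).
  by rewrite exchange_big; apply: eq_bigr => u _; rewrite exchange_big.
rewrite !sumP in h1.
rewrite -(leq_add2l (pair_sum (fun u v => \sum_(a < k) (f u != f v) * w u v))).
apply: (leq_trans (leq_add h1 (leqnn _))).
rewrite pair_sumM !pair_sumD; apply: leq_pair_sum => u v.
have sum1 (b : 'I_k) (c : nat) : \sum_a (a == b) * c = c.
  by rewrite (bigD1 b) //= eqxx mul1n big1 ?addn0 // => a /negbTE ->.
(* A pair separated by [f] only is charged to its common label under [g], a pair separated by [g]
   only to both of its labels under [g], whence the factor 2. The inequality then holds for each
   pair and each label [a] separately. *)
have -> : ((f u != f v) && (g u == g v)) * w u v =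
    \sum_a (a == g u) * (((f u != f v) && (g u == g v)) * w u v) by rewrite sum1.
have -> : 2 * (((g u != g v) && (f u == f v)) * w u v) =
    \sum_a ((a == g u) * (((g u != g v) && (f u == f v)) * w u v) +
            (a == g v) * (((g u != g v) && (f u == f v)) * w u v)).
  by rewrite big_split /= !sum1 mul2n addnn.
rewrite -!big_split; apply: leq_sum => a _ /=; rewrite /expand !inE.
rewrite !(eq_sym a) !mulnA -!mulnDl leq_mul2r; apply/orP; right.
case: (g u =P a) => [gu|gu]; case: (g v =P a) => [gv|gv] /=.
- by rewrite gu gv !eqxx /=; case: (f u == f v).
- rewrite gu; have -> : (a == g v) = false by apply/eqP => e; apply: gv.
  rewrite andbF /=; case: (f v =P a) => [->|fv]; rewrite ?eqxx /=; first by [].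
  by case: (f u == f v); case: (a == f v).
- rewrite gv; have -> : (g u == a) = false by apply/eqP.
  rewrite andbF /=; case: (f u =P a) => [->|fu]; rewrite ?eqxx /=; first by [].
  by case: (f u == f v); case: (f u == a).
- rewrite !mul0n !addn0; case: (f u =P a) => [->|fu]; case: (f v =P a) => [->|fv] //.
Qed.

End Labellings.

(** * The local search program *)

Local Notation x_u := 0 (only parsing).
Local Notation x_v := 1 (only parsing).
Local Notation x_t := 2 (only parsing).
Local Notation x_w := 3 (only parsing).
Local Notation x_iter := 4 (only parsing).
Local Notation x_n := 5 (only parsing).
Local Notation x_k := 6 (only parsing).
Local Notation x_bound := 7 (only parsing).
Local Notation x_a := 8 (only parsing).
Local Notation x_source := 9 (only parsing).
Local Notation x_done := 10 (only parsing).
Local Notation x_unit := 11 (only parsing).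
Local Notation x_round := 12 (only parsing).
Local Notation x_parent := 13 (only parsing).
Local Notation x_walk := 14 (only parsing).
Local Notation a_input := 0 (only parsing).
Local Notation a_row := 1 (only parsing).
Local Notation a_label := 2 (only parsing).
Local Notation a_terminal := 3 (only parsing).
Local Notation a_cap := 4 (only parsing).
Local Notation a_dist := 5 (only parsing).
Local Notation a_parent := 6 (only parsing).
Local Notation a_output := 7 (only parsing).

(** The offset [u * n] of row [u] comes from a table filled by additions, as the machine cannot
    multiply. *)
Definition entry (x y : nat) : expr := Plus (At a_row (Var x)) (Var y).
(** Array 0 is indexed from 1: [n], [k], then the terminals from 3 on and the matrix from [3 + k]
    on. *)
Definition weight_at (x y : nat) : expr :=
  At a_input (Plus (Plus (Num 3) (Var x_k)) (entry x y)).
Definition terminal_at (x : nat) : expr := At a_input (Plus (Num 3) (Var x)).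
Definition cap_at (x y : nat) : expr := At a_cap (entry x y).
Definition label_at (x : nat) : expr := At a_label (Var x).
Definition dist_at (x : nat) : expr := At a_dist (Var x).
(** At least one of the truncated differences is 0, so the value is the distance between the two
    numbers. *)
Definition differ (e1 e2 : expr) : expr := Plus (Minus e1 e2) (Minus e2 e1).

Definition if_split (c1 c2 : stmt) : stmt :=
  If (differ (label_at x_u) (Var x_a))
    (If (differ (label_at x_v) (Var x_a))
      (If (differ (label_at x_u) (label_at x_v)) c1 c2) c2) c2.

Definition set_entry : stmt :=
  Seq (Assign x_w (weight_at x_u x_v))
    (if_split (Put a_cap (entry x_u x_v) (Var x_w))
              (Put a_cap (entry x_u x_v) (Plus (Var x_w) (Var x_w)))).

Definition set_entries : stmt := For x_u x_n (For x_v x_n set_entry).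

Definition add_split : stmt :=
  if_split (Assign x_t (Plus (Var x_t) (weight_at x_u x_v))) Skip.

Definition add_source_edge : stmt :=
  Seq (Assign x_t (Num 0))
  (Seq (For x_v x_n add_split)
       (Put a_cap (entry x_source x_u) (Plus (cap_at x_source x_u) (Var x_t)))).

Definition build_network : stmt :=
  Seq (Assign x_source (terminal_at x_a))
  (Seq set_entries (For x_u x_n add_source_edge)).

Definition start_search : stmt :=
  For x_v x_n (If (differ (label_at x_v) (Var x_a))
                 (Put a_dist (Var x_v) (Num 0)) (Put a_dist (Var x_v) (Num 1))).

(* Distance 0 means not reached, and the sources, that is the vertices labelled a,
   are at distance 1. *)
Definition visit : stmt :=
  If (dist_at x_v) Skip
    (If (cap_at x_u x_v)
       (Seq (Put a_dist (Var x_v) (Plus (Var x_round) (Num 2)))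
            (Put a_parent (Var x_v) (Var x_u))) Skip).

(** A vertex found in the current round has distance [x_round + 2] and fails the second test, so it
    is scanned in later rounds only, and every parent has been reached before the round of its
    child. *)
Definition scan : stmt :=
  If (dist_at x_u)
    (If (Minus (Plus (Var x_round) (Num 2)) (dist_at x_u)) (For x_v x_n visit) Skip) Skip.

Definition search_round : stmt := For x_u x_n scan.

Definition search : stmt := Seq start_search (For x_round x_n search_round).

(* The sinks are the terminals that are not labelled a, hence not at distance 1. *)
Definition test_sink : stmt :=
  If (At a_terminal (Var x_v))
    (If (Minus (dist_at x_v) (Num 1)) (Assign x_t (Var x_v)) Skip) Skip.

Definition find_sink : stmt := Seq (Assign x_t (Var x_n)) (For x_v x_n test_sink).

Definition push_back : stmt :=
  Seq (Assign x_parent (At a_parent (Var x_t)))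
  (Seq (Put a_cap (entry x_parent x_t) (Minus (cap_at x_parent x_t) (Num 1)))
  (Seq (Put a_cap (entry x_t x_parent) (Plus (cap_at x_t x_parent) (Num 1)))
       (Assign x_t (Var x_parent)))).

Definition augment : stmt :=
  For x_walk x_n (If (Minus (dist_at x_t) (Num 1)) push_back Skip).

Definition flow_step : stmt :=
  Seq search
  (Seq find_sink
       (If (Minus (Var x_n) (Var x_t)) augment (Assign x_done (Num 1)))).

(** The flag turns all iterations after a search without sink into no-ops, so the final distances
    are those of that search. *)
Definition flow : stmt :=
  Seq (Assign x_done (Num 0)) (For x_unit x_bound (If (Var x_done) Skip flow_step)).

Definition relabel : stmt :=
  For x_v x_n (If (dist_at x_v) (Put a_label (Var x_v) (Var x_a)) Skip).

Definition expansion : stmt := Seq build_network (Seq flow relabel).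

Definition local_search : stmt := For x_iter x_bound (For x_a x_k expansion).

Definition read_sizes : stmt :=
  Seq (Assign x_n (At a_input (Num 1))) (Assign x_k (At a_input (Num 2))).

Definition set_rows : stmt :=
  Seq (Assign x_t (Num 0))
    (For x_u x_n (Seq (Put a_row (Var x_u) (Var x_t))
                      (Assign x_t (Plus (Var x_t) (Var x_n))))).

Definition set_bound : stmt :=
  Seq (Assign x_bound (Num 1))
    (For x_u x_n (For x_v x_n
       (Assign x_bound (Plus (Var x_bound) (weight_at x_u x_v))))).

Definition clear_labels : stmt :=
  For x_u x_n (Seq (Put a_label (Var x_u) (Num 0)) (Put a_terminal (Var x_u) (Num 0))).

Definition label_terminals : stmt :=
  For x_u x_k
    (Seq (Assign x_t (terminal_at x_u))
    (Seq (Put a_label (Var x_t) (Var x_u)) (Put a_terminal (Var x_t) (Num 1)))).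

Definition write_output : stmt :=
  Seq (Put a_output (Var x_n) (Var x_n))
    (For x_v x_n (Put a_output (Plus (Plus (Var x_n) (Num 1)) (Var x_v)) (label_at x_v))).

Definition preparation : stmt :=
  Seq set_rows (Seq clear_labels (Seq label_terminals set_bound)).

Definition multiway_cut_program : stmt :=
  Seq read_sizes (Seq preparation (Seq local_search write_output)).

Lemma wf_multiway_cut_program : wf multiway_cut_program.
Proof. by []. Qed.

(** The frame ties each intermediate state to [s], so an invariant only has to mention what the body
    changes. The conclusion has the index [var s x], hence the goals restated with [var s x_n] in
    place of [n] before its uses. *)
Lemma for_ind (I : nat -> state -> Prop) i x b s :
  I 0 (setv s i 0) ->
  (forall j s', j < var s x -> frame (For i x b) s s' -> var s' i = j -> I j s' ->
     I j.+1 (setv (sem b s') i j.+1)) ->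
  I (var s x) (sem (For i x b) s).
Proof.
move=> h0 h; have : var s x <= var s x by [].
rewrite [sem _ _]/=; elim: {1 3 4}(var s x) => [|j ih] //= jN.
apply: h => //; last exact: ih (ltnW jN).
  by apply: frame_loop => s'; apply: frame_sem.
by case: (j) => [|j']; rewrite /= /upd eqxx.
Qed.

Lemma sem_seq a b s : sem (Seq a b) s = sem b (sem a s).
Proof. by []. Qed.

Lemma sem_if e a b s : sem (If e a b) s = if eval e s != 0 then sem a s else sem b s.
Proof. by []. Qed.

Lemma differ_eq0 e1 e2 s : (eval (differ e1 e2) s != 0) = (eval e1 s != eval e2 s).
Proof. by rewrite /=; lia. Qed.

Lemma sum_prefixS n (F : 'I_n -> nat) (u : 'I_n) :
  \sum_(z < n | z < u.+1) F z = F u + \sum_(z < n | z < u) F z.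
Proof.
rewrite (bigD1 u) //=; congr (_ + _); apply: eq_bigl => z.
by rewrite -val_eqE /=; lia.
Qed.

(** * Correctness of the program: program states and the network *)

Section Verification.
Variables (n k : nat) (w : 'I_n -> 'I_n -> nat) (term : 'I_k -> 'I_n).
Hypothesis w_sym : forall u v, w u v = w v u.

Definition input_read (s : state) : Prop :=
  [/\ var s x_n = n, var s x_k = k,
      forall i : 'I_k, arr s a_input (3 + i) = term i &
      forall u v : 'I_n, arr s a_input (3 + k + (u * n + v)) = w u v].

Definition rows_set (s : state) : Prop := forall u : 'I_n, arr s a_row u = u * n.

Definition terminals_set (s : state) : Prop :=
  forall v : 'I_n, (arr s a_terminal v != 0) = [exists i, v == term i].

Definition prepared (s : state) : Prop :=
  [/\ input_read s, rows_set s & terminals_set s].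

Definition labelled (f : 'I_n -> 'I_k) (s : state) : Prop :=
  forall v : 'I_n, arr s a_label v = f v.

Definition capacity (s : state) (u v : 'I_n) : nat := arr s a_cap (u * n + v).

(** A boolean, so that for a concrete program the side condition is proved by computation, as
    [isT]. *)
Definition preserves (c : stmt) (vs rs : seq nat) : bool :=
  all (fun x => x \notin wvars c) vs && all (fun a => a \notin warrs c) rs.

Lemma input_read_frame c s s' : frame c s s' ->
  preserves c [:: x_n; x_k] [:: a_input] -> input_read s -> input_read s'.
Proof.
move=> [hv ha] /andP[/and3P[p1 p2 _] /andP[q _]] [h1 h2 h3 h4].
by split; rewrite ?hv ?ha.
Qed.

Lemma prepared_frame c s s' : frame c s s' ->
  preserves c [:: x_n; x_k] [:: a_input; a_row; a_terminal] -> prepared s -> prepared s'.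
Proof.
move=> h /andP[p /and4P[q1 q2 q3 _]] [h1 h2 h3]; have [_ ha] := h.
split; first by apply: input_read_frame h _ h1; rewrite /preserves p /= q1.
  by move=> u; rewrite ha.
by move=> v; rewrite ha.
Qed.

Lemma labelled_frame c f s s' : frame c s s' -> a_label \notin warrs c ->
  labelled f s -> labelled f s'.
Proof. by move=> [_ ha] q h v; rewrite ha. Qed.

Lemma entry_inj (u v x y : 'I_n) : (x * n + y == u * n + v) = (x == u) && (y == v).
Proof.
have n0 : 0 < n by apply: leq_ltn_trans (ltn_ord u).
apply/eqP/andP => [e|[/eqP -> /eqP ->]] //.
have exu : x = u :> nat.
  by have := congr1 (divn^~ n) e; rewrite /= !divnMDl // !divn_small // !addn0.
by split; apply/eqP/val_inj => //=; move: e; rewrite exu => /addnI.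
Qed.

Lemma eval_entry s x y (u v : 'I_n) : rows_set s -> var s x = u -> var s y = v ->
  eval (entry x y) s = u * n + v.
Proof. by move=> hr /= -> ->; rewrite hr. Qed.

Lemma eval_weight s x y (u v : 'I_n) : prepared s -> var s x = u -> var s y = v ->
  eval (weight_at x y) s = w u v.
Proof.
move=> [[_ hk _ hw] hr _] hu hv.
by rewrite -hw -(eval_entry hr hu hv) /= hk.
Qed.

Lemma sem_if_split c1 c2 s f (a : 'I_k) (u v : 'I_n) :
  labelled f s -> var s x_a = a -> var s x_u = u -> var s x_v = v ->
  sem (if_split c1 c2) s = if split_pair f a u v then sem c1 s else sem c2 s.
Proof.
move=> hl ha hu hv; rewrite /if_split; cbn [sem]; rewrite !differ_eq0; cbn [eval].
rewrite [eval (label_at _) _]/= [eval (label_at x_v) _]/= ha hu hv !hl /split_pair.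
rewrite -!val_eqE /=.
by case: (f u == a :> nat); case: (f v == a :> nat); case: (f u == f v :> nat).
Qed.


Definition base_capacity f (a : 'I_k) (u v : 'I_n) : nat :=
  w u v + ~~ split_pair f a u v * w u v.

Lemma sem_set_entry s f (a : 'I_k) (u v : 'I_n) :
  prepared s -> labelled f s -> var s x_a = a -> var s x_u = u -> var s x_v = v ->
  forall x y, capacity (sem set_entry s) x y =
    if (x == u) && (y == v) then base_capacity f a u v else capacity s x y.
Proof.
move=> hp hl ha hu hv x y; rewrite /set_entry; cbn [sem].
have hw := eval_weight hp hu hv; rewrite hw.
set s1 := setv _ _ _.
have hr1 : rows_set s1 by case: hp.
have e1 := eval_entry hr1 (hu : var s1 x_u = u) (hv : var s1 x_v = v).
rewrite (@sem_if_split _ _ s1 f a u v) // /base_capacity; cbn [sem].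
by case: split_pair; rewrite e1 /capacity /= /upd entry_inj /= ?mul1n ?mul0n ?addn0.
Qed.

Lemma sem_set_entries s f (a : 'I_k) :
  prepared s -> labelled f s -> var s x_a = a ->
  forall u v, capacity (sem set_entries s) u v = base_capacity f a u v.
Proof.
move=> hp hl ha; have hn : var s x_n = n by case: hp => -[].
suff : forall u v : 'I_n, u < var s x_n ->
    capacity (sem set_entries s) u v = base_capacity f a u v.
  by move=> h u v; apply: h; rewrite hn.
rewrite /set_entries; apply: (@for_ind (fun j s' => forall u v : 'I_n, u < j ->
  capacity s' u v = base_capacity f a u v)) => // j s1 hj fr1 hu1 I1.
rewrite hn in hj; pose u := Ordinal hj.
have hp1 := prepared_frame fr1 isT hp; have hl1 := labelled_frame fr1 isT hl.
have ha1 : var s1 x_a = a by rewrite fr1.1.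
have hn1 : var s1 x_n = n by rewrite fr1.1.
(* The entries filled so far are those before the current one in row-major order. *)
have I2 : forall x y : 'I_n, (x < u) || (x == u) && (y < var s1 x_n) ->
    capacity (sem (For x_v x_n set_entry) s1) x y = base_capacity f a x y.
  apply: (@for_ind (fun j s' => forall x y : 'I_n, (x < u) || (x == u) && (y < j) ->
    capacity s' x y = base_capacity f a x y)) => [x y|i s2 hi fr2 hv2 I2 x y].
    by rewrite ltn0 andbF orbF; apply: I1.
  rewrite hn1 in hi; pose v := Ordinal hi.
  have hp2 := prepared_frame fr2 isT hp1; have hl2 := labelled_frame fr2 isT hl1.
  have ha2 : var s2 x_a = a by rewrite fr2.1.
  have hu2 : var s2 x_u = u by rewrite fr2.1.
  move=> hxy; transitivity (capacity (sem set_entry s2) x y) => //.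
  rewrite (sem_set_entry hp2 hl2 ha2 hu2 (hv2 : _ = nat_of_ord v)).
  case: ifP => [/andP[/eqP -> /eqP ->] //|hne]; apply: I2.
  by move: hxy hne; rewrite -!val_eqE /=; lia.
move=> x y hx; rewrite -I2 // -val_eqE /= hn1; have := ltn_ord y; lia.
Qed.

Definition source_capacity f (a : 'I_k) (v : 'I_n) : nat :=
  \sum_z split_pair f a v z * w v z.

Lemma sem_add_splits s f (a : 'I_k) (u : 'I_n) :
  prepared s -> labelled f s -> var s x_a = a -> var s x_u = u -> var s x_t = 0 ->
  var (sem (For x_v x_n add_split) s) x_t = source_capacity f a u.
Proof.
move=> hp hl ha hu ht; have hn : var s x_n = n by case: hp => -[].
suff : var (sem (For x_v x_n add_split) s) x_t =
    \sum_(z < n | z < var s x_n) split_pair f a u z * w u z.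
  by rewrite hn => ->; apply: eq_bigl => z; rewrite ltn_ord.
apply: (@for_ind (fun j s' => var s' x_t =
  \sum_(z < n | z < j) split_pair f a u z * w u z)) => [|j s1 hj fr hv I].
  by rewrite big_pred0_eq.
rewrite hn in hj; pose v := Ordinal hj.
have hp1 := prepared_frame fr isT hp; have hl1 := labelled_frame fr isT hl.
have ha1 : var s1 x_a = a by rewrite fr.1.
have hu1 : var s1 x_u = u by rewrite fr.1.
rewrite (sum_prefixS _ v) -I; transitivity (var (sem add_split s1) x_t) => //.
rewrite /add_split (sem_if_split _ _ hl1 ha1 hu1 (hv : _ = nat_of_ord v)).
case: split_pair => //; cbn [sem eval].
by rewrite (eval_weight hp1 hu1 (hv : _ = nat_of_ord v)) mul1n addnC.
Qed.

Lemma sem_build_network s f (a : 'I_k) :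
  prepared s -> labelled f s -> var s x_a = a ->
  forall u v, capacity (sem build_network s) u v = network w term f a u v.
Proof.
move=> hp hl ha.
have hterm : eval (terminal_at x_a) s = term a by case: hp => -[_ _ + _] _ _ => <-; rewrite /= ha.
rewrite /build_network; cbn [sem]; rewrite hterm; set s0 := setv _ _ _.
have hp0 : prepared s0 by []. have hl0 : labelled f s0 by [].
have cap1 := sem_set_entries hp0 hl0 (ha : var s0 x_a = a).
have fr0 := frame_sem set_entries s0.
have hp1 := prepared_frame fr0 isT hp0; have hl1 := labelled_frame fr0 isT hl0.
have ha1 : var (sem set_entries s0) x_a = a by rewrite fr0.1.
have hs1 : var (sem set_entries s0) x_source = term a by rewrite fr0.1.
move: (sem set_entries s0) cap1 hp1 hl1 ha1 hs1 => s1 cap1 hp1 hl1 ha1 hs1 {s0 hp0 hl0 fr0}.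
have hn : var s1 x_n = n by case: hp1 => -[].
suff : forall x y : 'I_n, capacity (sem (For x_u x_n add_source_edge) s1) x y =
    base_capacity f a x y + (x == term a) * ((y < var s1 x_n) * source_capacity f a y).
  by move=> h x y; rewrite h hn ltn_ord mul1n.
apply: (@for_ind (fun j s' => forall x y : 'I_n, capacity s' x y =
    base_capacity f a x y + (x == term a) * ((y < j) * source_capacity f a y))).
  by move=> x y; rewrite ltn0 muln0 addn0 -cap1.
move=> j s2 hj fr hu I; rewrite hn in hj; pose u := Ordinal hj.
have hp2 := prepared_frame fr isT hp1; have hl2 := labelled_frame fr isT hl1.
have ha2 : var s2 x_a = a by rewrite fr.1.
have hs2 : var s2 x_source = term a by rewrite fr.1.
rewrite /add_source_edge !sem_seq; set s3 := sem (Assign x_t (Num 0)) s2.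
have hp3 : prepared s3 by []. have hl3 : labelled f s3 by [].
have ht := sem_add_splits hp3 hl3 (ha2 : var s3 x_a = a) (hu : var s3 x_u = u) erefl.
have fr3 := frame_sem (For x_v x_n add_split) s3.
have hr : rows_set (sem (For x_v x_n add_split) s3).
  by case: (prepared_frame fr3 isT hp3).
have hu3 : var (sem (For x_v x_n add_split) s3) x_u = u by rewrite fr3.1.
have hs3 : var (sem (For x_v x_n add_split) s3) x_source = term a by rewrite fr3.1.
have ca : arr (sem (For x_v x_n add_split) s3) a_cap = arr s2 a_cap by rewrite fr3.2.
move: (sem (For x_v x_n add_split) s3) ht hr hu3 hs3 ca {fr3} => s4 ht hr hu3 hs3 ca.
cbn [sem eval]; rewrite ht (eval_entry hr hs3 hu3) /cap_at; cbn [eval].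
rewrite (eval_entry hr hs3 hu3) ca.
move=> x y; transitivity (if x * n + y == term a * n + u
  then capacity s2 (term a) u + source_capacity f a u else arr s4 a_cap (x * n + y)) => //.
rewrite entry_inj ca -/(capacity s2 x y) !I -(inj_eq val_inj y) /= ltnS [y <= j]leq_eqVlt.
case: (x =P term a) => [->|_] /=; last by rewrite !mul0n.
rewrite eqxx !mul1n ltnn mul0n addn0.
by case: (y =P j :> nat) => [yj|//]; rewrite mul1n (_ : y = u) //; apply: val_inj.
Qed.

(** * Search in the residual network *)

Definition dist (s : state) (v : 'I_n) : nat := arr s a_dist v.

(** The strict decrease of the distance towards the parent makes the walk back from a sink end at a
    source without using an edge twice. *)
Definition search_tree f (a : 'I_k) (s : state) : Prop :=
  (forall v, (dist s v == 1) = (f v == a)) /\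
  (forall v, 1 < dist s v -> exists u : 'I_n,
     [/\ arr s a_parent v = u, 0 < dist s u < dist s v & 0 < capacity s u v]).

Definition search_closed (s : state) : Prop :=
  forall u v, 0 < dist s u -> 0 < capacity s u v -> 0 < dist s v.

Lemma sem_start_search s f (a : 'I_k) :
  prepared s -> labelled f s -> var s x_a = a ->
  forall v, dist (sem start_search s) v = (f v == a).
Proof.
move=> hp hl ha; have hn : var s x_n = n by case: hp => -[].
suff : forall v : 'I_n, v < var s x_n -> dist (sem start_search s) v = (f v == a).
  by move=> h v; apply: h; rewrite hn.
apply: (@for_ind (fun j s' => forall v : 'I_n, v < j -> dist s' v = (f v == a)))
  => // j s1 hj fr hv I v vj.
have hl1 := labelled_frame fr isT hl; have ha1 : var s1 x_a = a by rewrite fr.1.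
rewrite hn in hj; pose x := Ordinal hj; rewrite -[j]/(val x) in hv.
transitivity (if v == x then nat_of_bool (f x == a) else dist s1 v).
  rewrite sem_if differ_eq0; cbn [eval label_at]; rewrite ha1 hv hl1 if_neg.
  rewrite /dist -(inj_eq val_inj v) -(inj_eq val_inj (f x)) /=.
  by case: (f x == a :> nat); rewrite /= /upd hv.
case: (v =P x) => [->|/eqP vx] //; apply: I.
by move: vx vj; rewrite -val_eqE /= ltnS leq_eqVlt => /negbTE ->.
Qed.

Section Round.
Variables (r : nat) (s0 : state).

(** The parent of a new vertex has to be reached already in [s0], where distances are at most [r.+1]
    when this is applied; this gives the strict increase along the tree. *)
Definition round_inv (s : state) : Prop :=
  forall v, if 0 < dist s0 v then dist s v = dist s0 v /\ arr s a_parent v = arr s0 a_parent v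
    else dist s v = 0 \/ dist s v = r.+2 /\ exists u : 'I_n,
      [/\ arr s a_parent v = u, 0 < dist s0 u & 0 < capacity s0 u v].

Lemma sem_visit s (u v : 'I_n) :
  prepared s -> var s x_round = r -> var s x_u = u -> var s x_v = v ->
  capacity s =2 capacity s0 -> round_inv s -> 0 < dist s0 u ->
  [/\ round_inv (sem visit s), forall x, 0 < dist s x -> 0 < dist (sem visit s) x &
      0 < capacity s0 u v -> 0 < dist (sem visit s) v].
Proof.
move=> hp hr hu hv hc I du; rewrite /visit sem_if.
have -> : eval (dist_at x_v) s = dist s v by rewrite /= hv.
case: ifP => [dv|/negbFE/eqP dv]; first by split=> // _; rewrite lt0n.
have -> : sem (If (cap_at x_u x_v) (Seq (Put a_dist (Var x_v) (Plus (Var x_round) (Num 2)))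
            (Put a_parent (Var x_v) (Var x_u))) Skip) s =
  if capacity s u v != 0 then seta (seta s a_dist v r.+2) a_parent v u else s.
  rewrite sem_if {1}/cap_at; cbn [eval]; rewrite (eval_entry _ hu hv); last by case: hp.
  by rewrite -/(capacity s u v) /= hr hu hv addn2.
rewrite hc; case: ifP => [cuv|/negbFE/eqP ->]; last by split.
have dE x : dist (seta (seta s a_dist v r.+2) a_parent v u) x =
            if x == v then r.+2 else dist s x by [].
split; last by rewrite dE eqxx.
  move=> x; rewrite dE; have := I x; case: (x =P v) => [->|xv].
    case: ifP => [d0|_ _]; first by rewrite dv => -[e]; rewrite -e in d0.
    by right; split=> //; exists u; rewrite /= /upd eqxx; split=> //; rewrite lt0n.
  by rewrite /= /upd (_ : (x == v :> nat) = false) //; apply/eqP => /val_inj.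
by move=> x; rewrite dE; case: ifP.
Qed.

Lemma sem_visits s (u : 'I_n) :
  prepared s -> var s x_round = r -> var s x_u = u ->
  capacity s =2 capacity s0 -> round_inv s -> 0 < dist s0 u ->
  let s' := sem (For x_v x_n visit) s in
  [/\ round_inv s', forall x, 0 < dist s x -> 0 < dist s' x &
      forall v, 0 < capacity s0 u v -> 0 < dist s' v].
Proof.
move=> hp hr hu hc I du; have hn : var s x_n = n by case: hp => -[].
suff [h1 h2 h3] : [/\ round_inv (sem (For x_v x_n visit) s),
      forall x, 0 < dist s x -> 0 < dist (sem (For x_v x_n visit) s) x &
      forall v : 'I_n, v < var s x_n -> 0 < capacity s0 u v ->
        0 < dist (sem (For x_v x_n visit) s) v].
  by split=> // v; apply: h3; rewrite hn.
apply: (@for_ind (fun j s' => [/\ round_inv s', forall x, 0 < dist s x -> 0 < dist s' x &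
      forall v : 'I_n, v < j -> 0 < capacity s0 u v -> 0 < dist s' v])) => //.
move=> j s1 hj fr hv [I1 I2 I3]; rewrite hn in hj; pose v := Ordinal hj.
have hp1 := prepared_frame fr isT hp.
have hr1 : var s1 x_round = r by rewrite fr.1.
have hu1 : var s1 x_u = u by rewrite fr.1.
have hc1 : capacity s1 =2 capacity s0 by move=> x y; rewrite -hc /capacity fr.2.
have [J1 J2 J3] := sem_visit hp1 hr1 hu1 (hv : _ = nat_of_ord v) hc1 I1 du.
split=> //; first by move=> x /I2 /J2.
move=> x; rewrite ltnS leq_eqVlt => /orP[/eqP xj|xj] cx; last exact/J2/I3.
by have xv : x = v by [apply: val_inj]; rewrite xv in cx *; apply: J3.
Qed.

Lemma sem_search_round :
  prepared s0 -> var s0 x_round = r -> (forall v, dist s0 v <= r.+1) ->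
  let s' := sem search_round s0 in
  round_inv s' /\ forall u v, 0 < dist s0 u -> 0 < capacity s0 u v -> 0 < dist s' v.
Proof.
move=> hp hr hd; have hn : var s0 x_n = n by case: hp => -[].
suff [h1 h2] : round_inv (sem search_round s0) /\
    forall u v : 'I_n, u < var s0 x_n -> 0 < dist s0 u -> 0 < capacity s0 u v ->
      0 < dist (sem search_round s0) v.
  by split=> // u v; apply: h2; rewrite hn.
apply: (@for_ind (fun j s' => round_inv s' /\ forall u v : 'I_n, u < j ->
   0 < dist s0 u -> 0 < capacity s0 u v -> 0 < dist s' v)).
  by split=> // v; case: ifP => // /negbT; rewrite -eqn0Ngt => /eqP d0; left.
move=> j s1 hj fr hu [I1 I2]; rewrite hn in hj; pose u := Ordinal hj.
have hp1 := prepared_frame fr isT hp.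
have hr1 : var s1 x_round = r by rewrite fr.1.
have hc1 : capacity s1 =2 capacity s0 by move=> x y; rewrite /capacity fr.2.
have -> : sem scan s1 = if 0 < dist s0 u then sem (For x_v x_n visit) s1 else s1.
  rewrite /scan !sem_if.
  have -> : eval (dist_at x_u) s1 = dist s1 u by rewrite /= hu.
  have -> : eval (Minus (Plus (Var x_round) (Num 2)) (dist_at x_u)) s1 = r.+2 - dist s1 u.
    by rewrite /= hu hr1 addn2.
  have := I1 u; case: ifP => [d0 [-> _]|_ [->|[-> _]]] //.
    by rewrite -lt0n d0 subn_eq0 -ltnNge ltnS hd.
  by rewrite subnn.
case: ifP => [du|du]; last first.
  split=> // x v; rewrite ltnS leq_eqVlt => /orP[/eqP xj|xj]; last exact: I2.
  by have -> : x = u by [apply: val_inj]; rewrite du.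
have [J1 J2 J3] := sem_visits hp1 hr1 (hu : _ = nat_of_ord u) hc1 I1 du.
split=> // x v; rewrite ltnS leq_eqVlt => /orP[/eqP xj|xj] dx cx; last exact/J2/(I2 x).
by apply: J3; have <- : x = u by [apply: val_inj].
Qed.

End Round.

(** If nothing new can be found, the search is closed and stays so; otherwise a round reaches a new
    vertex. Starting from [u0], a search not yet closed has thus reached more than [j] vertices
    after [j] rounds, which is impossible for [j = n]. *)
Lemma sem_search s f (a : 'I_k) u0 :
  prepared s -> labelled f s -> var s x_a = a -> f u0 = a ->
  let s' := sem search s in
  [/\ search_tree f a s', search_closed s' & forall v, dist s' v <= n.+1].
Proof.
move=> hp hl ha fu; rewrite /search sem_seq.
have d1 := sem_start_search hp hl ha; have fr1 := frame_sem start_search s.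
have hp1 := prepared_frame fr1 isT hp.
move: (sem start_search s) d1 hp1 {fr1} => s1 d1 hp1 /=.
have hn : var s1 x_n = n by case: hp1 => -[].
pose reached s := [set v | 0 < dist s v].
suff : let s' := sem (For x_round x_n search_round) s1 in
    [/\ search_tree f a s', forall v, dist s' v <= (var s1 x_n).+1 &
        search_closed s' \/ var s1 x_n < #|reached s'|].
  case=> h1 h3 h2; rewrite hn in h2 h3; split=> //; case: h2 => // h2.
  by have := max_card (reached (sem (For x_round x_n search_round) s1));
    rewrite card_ord leqNgt h2.
apply: (@for_ind (fun j s' => [/\ search_tree f a s', forall v, dist s' v <= j.+1 &
        search_closed s' \/ j < #|reached s'|])).
  have dE v : dist (setv s1 x_round 0) v = (f v == a) by apply: d1.
  split; [by split=> v; rewrite dE; case: (f v == a)|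
          by move=> v; rewrite dE; case: (f v == a)|].
  by right; apply/card_gt0P; exists u0; rewrite inE dE fu eqxx.
move=> j s2 hj fr hr [[T1 T2] D C].
have hp2 := prepared_frame fr isT hp1.
have [R S] := sem_search_round hp2 hr D.
have cE : capacity (sem search_round s2) =2 capacity s2.
  by move=> x y; rewrite /capacity (frame_sem search_round s2).2.
have dE v : 0 < dist s2 v -> dist (sem search_round s2) v = dist s2 v.
  by move=> d0; have := R v; rewrite d0 => -[].
move: (sem search_round s2) R S cE dE => s3 R S cE dE.
suff : [/\ search_tree f a s3, forall v, dist s3 v <= j.+2 &
           search_closed s3 \/ j.+1 < #|reached s3|] by [].
split.
- split=> v.
    have := R v; rewrite -T1; case: ifP => [_ [-> _] //|]; case: (dist s2 v) => // _.
    by case=> [|[]] ->.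
  have := R v.
  case: ifP => [_ [dv pv]|_ [-> //|[dv [u [pu du cu]]]]] h1.
    rewrite dv in h1; have [u [pu /andP[du0 duv] cu]] := T2 v h1.
    by exists u; rewrite pv pu dv dE // du0 duv; split=> //; rewrite -cE in cu.
  by exists u; rewrite dv dE // du /= ltnS D cE.
- move=> v; have := R v.
  case: ifP => [_ [-> _]|_ [->|[-> _]]] //.
  by apply: leqW; apply: D.
- case: (boolP [forall u, forall v, (0 < dist s2 u) ==> (0 < capacity s2 u v) ==>
      (0 < dist s2 v)]) => [/forallP cl|ncl].
    have {}cl u v : 0 < dist s2 u -> 0 < capacity s2 u v -> 0 < dist s2 v.
      by move=> h1 h2; have /forallP/(_ v)/implyP/(_ h1)/implyP/(_ h2) := cl u.
    have same v : 0 < dist s3 v -> 0 < dist s2 v.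
      have := R v; case: ifP => // d0 [-> //|[_ [u [_ du cu]]]] _.
      by rewrite -d0; apply: cl du cu.
    left=> u v; rewrite cE.
    by move=> /same du cu; have dv := cl _ _ du cu; rewrite dE.
  right; case: C => [cl|C].
    case/forallPn: ncl => u /forallPn[v]; rewrite !negb_imply => /and3P[h1 h2].
    by rewrite (cl _ _ h1 h2).
  apply: leq_ltn_trans C _; apply: proper_card; apply/properP; split.
    by apply/subsetP => v; rewrite !inE => h; have -> := dE v h.
  case/forallPn: ncl => u /forallPn[v]; rewrite !negb_imply => /and3P[h1 h2 h3].
  by exists v; rewrite inE //; apply: S h1 h2.
Qed.

(** * Augmentations and minimum cuts *)

Definition sink (s : state) (v : 'I_n) : bool :=
  (arr s a_terminal v != 0) && (1 < dist s v).

(** The value [n], which is no vertex, stands for the absence of a sink. *)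
Lemma sem_find_sink s : prepared s ->
  let s' := sem find_sink s in
  (var s' x_t = n /\ forall v, ~~ sink s v) \/
  exists2 v : 'I_n, var s' x_t = v & sink s v.
Proof.
move=> hp; rewrite /find_sink sem_seq.
have hn : var (sem (Assign x_t (Var x_n)) s) x_n = n by case: hp => -[].
have hs : sink (sem (Assign x_t (Var x_n)) s) =1 sink s by [].
have ht : var (sem (Assign x_t (Var x_n)) s) x_t = n by case: hp => -[].
move: (sem (Assign x_t (Var x_n)) s) hn hs ht => s1 hn hs ht /=.
suff [[h1 h2]|h] : let s' := sem (For x_v x_n test_sink) s1 in
    (var s' x_t = n /\ forall v : 'I_n, v < var s1 x_n -> ~~ sink s v) \/
    exists2 v : 'I_n, var s' x_t = v & sink s v.
- by left; split=> // v; apply: h2; rewrite hn.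
- by right.
apply: (@for_ind (fun j s' =>
    (var s' x_t = n /\ forall v : 'I_n, v < j -> ~~ sink s v) \/
    exists2 v : 'I_n, var s' x_t = v & sink s v)) => [|j s2 hj fr hv I]; first by left.
rewrite hn in hj; pose v := Ordinal hj.
have -> : sem test_sink s2 = if sink s v then setv s2 x_t v else s2.
  rewrite /test_sink !sem_if -hs /sink /dist -fr.2 // -[arr s1 a_dist](fr.2) //.
  by rewrite /= hv subn_eq0 -ltnNge; case: (arr s2 3 j != 0).
case: ifP => hsv; first by right; exists v.
case: I => [[h1 h2]|//]; last by right.
left; split=> // u; rewrite ltnS leq_eqVlt => /orP[/eqP uj|]; last exact: h2.
by rewrite (_ : u = v) ?hsv //; apply: val_inj.
Qed.

Lemma sem_push_back s (u v : 'I_n) :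
  rows_set s -> var s x_t = v -> arr s a_parent v = u -> u != v ->
  let s' := sem push_back s in
  [/\ var s' x_t = u, arr s' a_dist = arr s a_dist, arr s' a_parent = arr s a_parent &
      forall x y, capacity s' x y = if (x == u) && (y == v) then (capacity s x y).-1
                                    else capacity s x y + ((x == v) && (y == u))].
Proof.
move=> hr ht hpar uv; rewrite /push_back !sem_seq.
have -> : sem (Assign x_parent (At a_parent (Var x_t))) s = setv s x_parent u.
  by rewrite /= ht hpar.
set s1 := setv s x_parent u.
have hr1 : rows_set s1 by [].
have ht1 : var s1 x_t = v by []. have hp1 : var s1 x_parent = u by [].
have e1 := eval_entry hr1 hp1 ht1; have e1' := eval_entry hr1 ht1 hp1.
have -> : sem (Put a_cap (entry x_parent x_t) (Minus (cap_at x_parent x_t) (Num 1))) s1 =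
    seta s1 a_cap (u * n + v) (capacity s u v).-1.
  by rewrite /cap_at; cbn [sem eval]; rewrite e1 subn1.
set s2 := seta _ _ _ _.
have e2 : eval (entry x_t x_parent) s2 = v * n + u by rewrite -e1'.
have -> : sem (Put a_cap (entry x_t x_parent) (Plus (cap_at x_t x_parent) (Num 1))) s2 =
    seta s2 a_cap (v * n + u) (capacity s2 v u).+1.
  by rewrite /cap_at; cbn [sem eval]; rewrite e2 addn1.
split=> // x y.
rewrite -[LHS]/(if x * n + y == v * n + u then (capacity s2 v u).+1 else capacity s2 x y).
have c2 z t : capacity s2 z t =
    if (z == u) && (t == v) then (capacity s u v).-1 else capacity s z t.
  by rewrite -entry_inj.
rewrite entry_inj !c2 [v == u]eq_sym (negbTE uv) /=.
case: (x =P v) => [->|_] /=; last by rewrite addn0; case: ifP => // /andP[/eqP -> /eqP ->].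
rewrite [v == u]eq_sym (negbTE uv) /=; case: (y =P u) => [->|_]; first by rewrite addn1.
by rewrite addn0.
Qed.

(** The walk stands at [t], having pushed a unit along the tree path from [t] to [t0], so by
    telescoping a cut has changed only through the memberships of [t] and [t0]. The distance starts
    at most at [n.+1] and drops in each step until it is 1, so [n] steps lead to a source. Tree
    edges into vertices no farther than [t] keep a positive capacity, because pushes only reduce
    edges into farther vertices. *)
Lemma sem_augment s f (a : 'I_k) (t0 : 'I_n) :
  prepared s -> search_tree f a s -> (forall v, dist s v <= n.+1) ->
  var s x_t = t0 -> 1 < dist s t0 ->
  forall A : {set 'I_n}, (forall u, f u = a -> u \in A) -> t0 \notin A ->
    (cut_weight (capacity (sem augment s)) A).+1 = cut_weight (capacity s) A.
Proof.
move=> hp [T1 T2] D ht d0 A hA t0A; have hn : var s x_n = n by case: hp => -[].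
suff [t [_ dpos dt _ /(_ A)]] : exists t : 'I_n, [/\ var (sem augment s) x_t = t, 0 < dist s t,
    dist s t <= (n - var s x_n).+1,
    forall v u : 'I_n, 1 < dist s v <= dist s t -> arr s a_parent v = u ->
      0 < capacity (sem augment s) u v &
    forall A : {set 'I_n}, cut_weight (capacity (sem augment s)) A + (t \in A) =
      cut_weight (capacity s) A + (t0 \in A)].
  have tA : t \in A by apply/hA/eqP; rewrite -T1; move: dt dpos; rewrite hn; lia.
  by move=> h; rewrite tA (negbTE t0A) addn0 addn1 in h.
apply: (@for_ind (fun j s' => exists t : 'I_n, [/\ var s' x_t = t, 0 < dist s t,
    dist s t <= (n - j).+1,
    forall v u : 'I_n, 1 < dist s v <= dist s t -> arr s a_parent v = u ->
      0 < capacity s' u v &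
    forall A : {set 'I_n}, cut_weight (capacity s') A + (t \in A) =
      cut_weight (capacity s) A + (t0 \in A)])).
  exists t0; split=> //; first exact: ltnW.
    by rewrite subn0.
  move=> v u /andP[dv _] hu; have [u' [hu' _ hc]] := T2 v dv.
  by have -> : u = u' by apply: val_inj; rewrite /= -hu -hu'.
move=> j s1 hj fr _ [t [ht1 dpos dt hc hcut]]; rewrite hn in hj.
have ds : arr s1 a_dist = arr s a_dist by rewrite fr.2.
have hp1 := prepared_frame fr isT hp; have [_ hr1 _] := hp1.
rewrite sem_if.
have -> : eval (Minus (dist_at x_t) (Num 1)) s1 = dist s t - 1 by rewrite /= ht1 ds.
rewrite subn_eq0 -ltnNge; case: ifP => [d1|/negbT]; last first.
  by rewrite -leqNgt => d1; exists t; split=> //; apply: leq_trans d1 _.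
have [u [hu /andP[du dut] cut]] := T2 t d1.
have hu1 : arr s1 a_parent t = u by rewrite -hu fr.2.
have ut : u != t by apply: contraTneq dut => ->; rewrite ltnn.
have [p1 _ _ p4] := sem_push_back hr1 ht1 hu1 ut.
have c0 : 0 < capacity s1 u t by apply: hc hu; rewrite d1 leqnn.
exists u; split=> //.
- by move: dut dt; lia.
- move=> v z /andP[dv dvu] hz; have := hc v z; rewrite dv (leq_trans dvu (ltnW dut)).
  move=> /(_ isT hz) cz; rewrite -[capacity _ _ _]/(capacity (sem push_back s1) z v) p4.
  case: ifP => [/andP[_ /eqP vt]|_]; first by rewrite vt leqNgt dut in dvu.
  by rewrite addn_gt0 cz.
- move=> B; have := cut_weight_push B ut c0 p4.
  have := hcut B.
  rewrite -[cut_weight (capacity (setv _ _ _)) B]/(cut_weight (capacity (sem push_back s1)) B).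
  lia.
Qed.

Definition flow_value f (a : 'I_k) (s : state) (phi : nat) : Prop :=
  forall A, expandable term f a A ->
    cut_weight (capacity s) A + phi = cut_weight (network w term f a) A.

Definition flow_done f (a : 'I_k) (s : state) : Prop :=
  [/\ search_tree f a s, search_closed s & forall v, ~~ sink s v].

Lemma sem_flow_step s f (a : 'I_k) phi :
  prepared s -> labelled f s -> var s x_a = a -> respects term f ->
  var s x_done = 0 -> flow_value f a s phi ->
  let s' := sem flow_step s in
  var s' x_done = 0 /\ flow_value f a s' phi.+1 \/
  [/\ var s' x_done = 1, flow_value f a s' phi & flow_done f a s'].
Proof.
move=> hp hl ha hf h0 hphi.
have -> : sem flow_step s =
  sem (If (Minus (Var x_n) (Var x_t)) augment (Assign x_done (Num 1)))
    (sem find_sink (sem search s)) by [].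
have [T C D] := sem_search hp hl ha (hf a).
have fr := frame_sem search s.
have hp1 := prepared_frame fr isT hp.
have hphi1 : flow_value f a (sem search s) phi.
  by move=> A /hphi <-; congr (_ + _); rewrite /capacity fr.2.
have h01 : var (sem search s) x_done = 0 by rewrite fr.1.
move: (sem search s) T C D hp1 hphi1 h01 {fr} => s1 T C D hp1 hphi1 h01.
have fr := frame_sem find_sink s1.
have hp2 := prepared_frame fr isT hp1.
have h02 : var (sem find_sink s1) x_done = 0 by rewrite fr.1.
have hs := sem_find_sink hp1.
have ar a' : a' \in [:: a_terminal; a_cap; a_dist; a_parent] ->
    arr (sem find_sink s1) a' = arr s1 a' by move=> _; rewrite fr.2.
move: (sem find_sink s1) hp2 h02 hs ar {fr} => s2 hp2 h02 hs ar.
have hphi2 : flow_value f a s2 phi.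
  by move=> A /hphi1 <-; congr (_ + _); rewrite /capacity ar.
have T2 : search_tree f a s2.
  case: T => t1 t2; split=> v; rewrite {1}/dist ar //; first exact: t1.
  by move=> /t2[u [? ? ?]]; exists u; rewrite /capacity /dist !ar.
have D2 v : dist s2 v <= n.+1 by rewrite /dist ar //; apply: D.
have K2 : sink s2 =1 sink s1 by move=> v; rewrite /sink /dist !ar.
have C2 : search_closed s2 by move=> u v; rewrite /dist /capacity !ar //; apply: C.
have hn : var s2 x_n = n by case: hp2 => -[].
rewrite sem_if.
have -> : eval (Minus (Var x_n) (Var x_t)) s2 = n - var s2 x_t by rewrite /= hn.
case: hs => [[-> nosink]|[t ht hsink]].
  rewrite subnn; right; split=> //; split=> // v.
  by rewrite -[sink _ _]/(sink s2 v) K2.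
rewrite ht -lt0n subn_gt0 ltn_ord.
have [ht1 dt] : arr s2 a_terminal t != 0 /\ 1 < dist s2 t by apply/andP; rewrite -K2 in hsink.
left; split; first by have [-> //] := frame_sem augment s2.
move=> A hA; rewrite -hphi2 // addnS -addSn; congr (_ + _).
apply: (sem_augment hp2 T2 D2 ht dt); first by case: hA.
have [_ _ ts] := hp2; have := ts t; rewrite ht1 => /esym/existsP[i /eqP ti].
rewrite ti; apply: hA.2; apply: contraTneq dt => ia; rewrite -leqNgt.
have [e1 _] := T2; have := e1 t; rewrite ti hf ia eqxx => /eqP ->.
by [].
Qed.

(** If every iteration augmented, the cut formed by the vertices labelled [a], whose weight is the
    cost of [f], would lose more than it has. *)
Lemma sem_flow s f (a : 'I_k) :
  prepared s -> labelled f s -> var s x_a = a -> respects term f ->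
  capacity s =2 network w term f a -> labelling_cost w f < var s x_bound ->
  let s' := sem flow s in
  exists2 phi, flow_value f a s' phi & flow_done f a s'.
Proof.
move=> hp hl ha hf hc hb; rewrite /flow sem_seq.
set s0 := sem (Assign x_done (Num 0)) s.
suff : let s' := sem (For x_unit x_bound (If (Var x_done) Skip flow_step)) s0 in
    var s' x_done = 0 /\ flow_value f a s' (var s0 x_bound) \/
    exists2 phi, flow_value f a s' phi & var s' x_done != 0 /\ flow_done f a s'.
  case=> [[_ h]|[phi h1 [_ h2]]]; last by exists phi.
  pose F := [set u | f u == a].
  have hF : expandable term f a F.
    by split=> [u fu|i ia]; rewrite inE ?fu ?hf.
  have := h F hF; rewrite cut_network //.
  rewrite expand_own.
  by move=> e; move: hb; rewrite -e -[var s x_bound]/(var s0 x_bound) ltnNge leq_addl.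
apply: (@for_ind (fun j s' => var s' x_done = 0 /\ flow_value f a s' j \/
    exists2 phi, flow_value f a s' phi & var s' x_done != 0 /\ flow_done f a s')).
  left; split=> // A _; rewrite addn0.
  by apply: eq_pair_sum => u v; rewrite -hc.
move=> j s1 _ fr _ [[h0 hphi]|[phi hphi [h1 hd]]]; rewrite sem_if; last first.
  by rewrite [eval _ _]/= h1; right; exists phi.
rewrite [eval _ _]/= h0 eqxx; cbv iota beta delta [negb].
have hp1 : prepared s1 by apply: prepared_frame fr isT _.
have hl1 : labelled f s1 by apply: labelled_frame fr isT _.
have ha1 : var s1 x_a = a by rewrite fr.1.
have [[k0 kphi]|[k1 kphi kd]] := sem_flow_step hp1 hl1 ha1 hf h0 hphi; first by left.
by right; exists j => //; split=> //; rewrite (_ : var _ _ = 1).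
Qed.

Lemma sem_relabel s f (a : 'I_k) :
  prepared s -> labelled f s -> var s x_a = a ->
  labelled (expand f a [set v | 0 < dist s v]) (sem relabel s).
Proof.
move=> hp hl ha v; have hn : var s x_n = n by case: hp => -[].
have -> : arr (sem relabel s) a_label v =
    if (v < var s x_n) && (0 < dist s v) then val a else val (f v).
  apply: (@for_ind (fun j s' => arr s' a_label v =
    if (v < j) && (0 < dist s v) then val a else val (f v))) => [|j s1 hj fr hv I].
    by rewrite ltn0 hl.
  have ha1 : var s1 x_a = a by rewrite fr.1.
  rewrite hn in hj; pose x := Ordinal hj; rewrite -[j]/(val x) in hv.
  have -> : sem (If (dist_at x_v) (Put a_label (Var x_v) (Var x_a)) Skip) s1 =
      if 0 < dist s x then seta s1 a_label x a else s1.
    by rewrite sem_if /= hv ha1 /dist -fr.2 // lt0n.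
  transitivity (if (v == x) && (0 < dist s x) then val a else arr s1 a_label v).
    by rewrite -val_eqE; case: (0 < dist s x); rewrite /= ?andbT ?andbF.
  rewrite I (ltnS v) (leq_eqVlt v) -val_eqE /=.
  case: (v =P j :> nat) => [vj|//]; have vx : v = x by apply: val_inj.
  by rewrite vj ltnn vx /=; case: ifP.
by rewrite hn ltn_ord /expand inE /=; case: ifP.
Qed.

(** * Expansion moves and the local search *)

Definition expansion_optimal f (a : 'I_k) : Prop :=
  forall A, expandable term f a A -> labelling_cost w f <= labelling_cost w (expand f a A).

Lemma expand_respects f (a : 'I_k) A :
  respects term f -> expandable term f a A -> respects term (expand f a A).
Proof.
move=> hf [_ hA] i; rewrite /expand; case: ifP => // iA.
by apply/eqP; apply: contraTT iA => ia; apply: hA; rewrite eq_sym.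
Qed.

Lemma flow_done_expandable s f (a : 'I_k) :
  terminals_set s -> respects term f -> flow_done f a s ->
  expandable term f a [set v | 0 < dist s v].
Proof.
move=> ts hf [[T1 _] _ nosink]; split=> [u fu|i ia].
  by rewrite inE; have := T1 u; rewrite fu eqxx => /eqP ->.
rewrite inE; have := nosink (term i); rewrite /sink ts.
have -> : [exists j, term i == term j] by apply/existsP; exists i.
have := T1 (term i); rewrite hf (negbTE ia).
by case: (dist s (term i)) => [|[|]].
Qed.

Lemma flow_done_closed s f (a : 'I_k) : flow_done f a s ->
  cut_weight (capacity s) [set v | 0 < dist s v] = 0.
Proof.
move=> [_ cl _]; apply/cut_weight_eq0 => u v; rewrite !inE => du dv.
by apply/eqP; rewrite -leqn0 leqNgt; apply: contra dv => /(cl _ _ du).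
Qed.

(** By strong induction on the distance: the parent of a vertex at distance more than 1 would have
    distance 1, hence label [a], and the tree edge would leave the cut with positive residual
    capacity. *)
Lemma unreached_of_own_cut s f (a : 'I_k) : flow_done f a s ->
  cut_weight (capacity s) [set u | f u == a] = 0 -> forall v, dist s v <= 1.
Proof.
move=> [[T1 T2] _ _] /cut_weight_eq0 h v.
elim: {v}(dist s v).+1 {-2}v (ltnSn (dist s v)) => // d ih v dv.
rewrite leqNgt; apply/negP => d1; have [u [_ /andP[du duv]]] := T2 v d1.
rewrite h // inE -T1; last by rewrite neq_ltn d1 orbT.
by rewrite eqn_leq du ih // (leq_trans duv).
Qed.

Lemma sem_expansion s f (a : 'I_k) :
  prepared s -> labelled f s -> var s x_a = a -> respects term f ->
  labelling_cost w f < var s x_bound ->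
  let s' := sem expansion s in
  labelled f s' /\ expansion_optimal f a \/
  exists f', [/\ labelled f' s', respects term f',
    labelling_cost w f' < labelling_cost w f & ~ expansion_optimal f a].
Proof.
move=> hp hl ha hf hb.
have -> : sem expansion s = sem relabel (sem flow (sem build_network s)) by [].
have c1 := sem_build_network hp hl ha.
have fr1 := frame_sem build_network s.
have hp1 := prepared_frame fr1 isT hp; have hl1 := labelled_frame fr1 isT hl.
have ha1 : var (sem build_network s) x_a = a by rewrite fr1.1.
have hb1 : labelling_cost w f < var (sem build_network s) x_bound by rewrite fr1.1.
move: (sem build_network s) c1 hp1 hl1 ha1 hb1 {fr1} => s1 c1 hp1 hl1 ha1 hb1.
have [phi fv fd] := sem_flow hp1 hl1 ha1 hf c1 hb1.
have fr2 := frame_sem flow s1.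
have hp2 := prepared_frame fr2 isT hp1; have hl2 := labelled_frame fr2 isT hl1.
have ha2 : var (sem flow s1) x_a = a by rewrite fr2.1.
move: (sem flow s1) fv fd hp2 hl2 ha2 {fr2} => s2 fv fd hp2 hl2 ha2 /=.
have hl3 := sem_relabel hp2 hl2 ha2.
set R := [set v | 0 < dist s2 v] in hl3.
have [_ _ ts] := hp2.
have hR : expandable term f a R := flow_done_expandable ts hf fd.
have cR : labelling_cost w (expand f a R) = phi.
  by rewrite -(cut_network w_sym (hf a) hR) -(fv R hR) (flow_done_closed fd).
have le_phi A : expandable term f a A -> phi <= labelling_cost w (expand f a A).
  by move=> hA; rewrite -(cut_network w_sym (hf a) hA) -(fv A hA) leq_addl.
pose F := [set u | f u == a].
have hF : expandable term f a F.
  by split=> [u fu|i ia]; rewrite inE ?fu ?hf.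
have cF : labelling_cost w f = cut_weight (capacity s2) F + phi.
  by rewrite fv // cut_network // expand_own.
(* By [cR] and [cF], this residual weight is exactly what the move gains. *)
case: (posnP (cut_weight (capacity s2) F)) => c0; last first.
  right; exists (expand f a R); split=> //; first exact: expand_respects.
    by rewrite cR cF -[X in X < _]add0n ltn_add2r.
  by move=> /(_ R hR); rewrite cR cF -[X in _ <= X]add0n leq_add2r leqNgt c0.
left; split; last by move=> A hA; rewrite cF c0; apply: le_phi.
have d1 := unreached_of_own_cut fd c0.
move=> v; rewrite hl3 /expand inE; case: ifP => // dv; congr val.
by apply/esym/eqP; have [[<- _] _ _] := fd; rewrite eqn_leq d1.
Qed.

(** In the first alternative every label was tested on the same labelling [f], which gives local
    optimality. The clause [~ locally_optimal] in the second one ensures that a local optimum, once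
    found, persists through the remaining passes. *)
Lemma sem_expansions s f :
  prepared s -> labelled f s -> respects term f ->
  (forall g : 'I_n -> 'I_k, labelling_cost w g < var s x_bound) ->
  let s' := sem (For x_a x_k expansion) s in
  exists f', [/\ labelled f' s', respects term f' &
    (f' = f /\ locally_optimal w term f) \/
    labelling_cost w f' < labelling_cost w f /\ ~ locally_optimal w term f].
Proof.
move=> hp hl hf hb; have hk : var s x_k = k by case: hp => -[].
suff [f' [h1 h2 h3]] : let s' := sem (For x_a x_k expansion) s in
  exists f', [/\ labelled f' s', respects term f' &
    (f' = f /\ forall a : 'I_k, a < var s x_k -> expansion_optimal f a) \/
    labelling_cost w f' < labelling_cost w f /\ ~ locally_optimal w term f].
  exists f'; split=> //; case: h3 => [[e h]|]; last by right.
  by left; split=> // a A; apply: h; rewrite hk.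
apply: (@for_ind (fun j s' => exists f', [/\ labelled f' s', respects term f' &
    (f' = f /\ forall a : 'I_k, a < j -> expansion_optimal f a) \/
    labelling_cost w f' < labelling_cost w f /\ ~ locally_optimal w term f])).
  by exists f; split=> //; left.
move=> j s1 hj fr ha [g [hl1 hg I]]; rewrite hk in hj; pose a := Ordinal hj.
have hp1 := prepared_frame fr isT hp.
have hb1 : labelling_cost w g < var s1 x_bound by rewrite fr.1.
case: (sem_expansion hp1 hl1 (ha : _ = nat_of_ord a) hg hb1) => [[h1 h2]|[g' [h1 h2 h3 h4]]].
  exists g; split=> //; case: I => [[gf I]|I]; [left|by right].
  split=> // b; rewrite ltnS leq_eqVlt => /orP[/eqP bj|]; last exact: I.
  by have -> : b = a; [apply: val_inj | rewrite -gf].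
exists g'; split=> //; right; case: I => [[gf _]|[lt nopt]].
  by rewrite gf in h3 h4; split=> // opt; apply: h4 => A; apply: opt.
by split=> //; apply: ltn_trans h3 lt.
Qed.

(** If no pass met a local optimum, [x_bound] strict decreases would need an initial cost of at
    least [x_bound]. *)
Lemma sem_local_search s f :
  prepared s -> labelled f s -> respects term f ->
  (forall g : 'I_n -> 'I_k, labelling_cost w g < var s x_bound) ->
  exists f', [/\ labelled f' (sem local_search s), respects term f' &
    locally_optimal w term f'].
Proof.
move=> hp hl hf hb.
suff [g [h1 h2 [|h3]]] : exists g, [/\ labelled g (sem local_search s), respects term g &
    locally_optimal w term g \/
    labelling_cost w g + var s x_bound <= labelling_cost w f].
- by exists g.
- by have := leq_trans (leq_addl _ _) h3; rewrite leqNgt hb.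
apply: (@for_ind (fun j s' => exists g, [/\ labelled g s', respects term g &
    locally_optimal w term g \/ labelling_cost w g + j <= labelling_cost w f])).
  by exists f; split=> //; right; rewrite addn0.
move=> j s1 _ fr _ [g [hl1 hg I]].
have hp1 : prepared s1 by apply: prepared_frame fr isT _.
have hb1 (g' : 'I_n -> 'I_k) : labelling_cost w g' < var s1 x_bound by rewrite fr.1.
have [g' [h1 h2 h3]] := sem_expansions hp1 hl1 hg hb1.
exists g'; split=> //; case: h3 => [[-> h]|[lt nopt]]; first by left.
case: I => [//|le]; right; rewrite addnS -addSn.
by apply: leq_trans le; rewrite leq_add2r.
Qed.

(** * Preparation of the data and output *)

Lemma sem_set_rows s : input_read s -> rows_set (sem set_rows s).
Proof.
move=> hp u; rewrite /set_rows sem_seq; set s0 := sem (Assign _ _) s.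
have hn : var s0 x_n = n by case: hp.
suff [_ h] : let s' := sem (For x_u x_n (Seq (Put a_row (Var x_u) (Var x_t))
                      (Assign x_t (Plus (Var x_t) (Var x_n))))) s0 in
    var s' x_t = var s0 x_n * n /\ forall u, u < var s0 x_n -> arr s' a_row u = u * n.
  by apply: h; rewrite hn.
apply: (@for_ind (fun j s' => var s' x_t = j * n /\
  forall u, u < j -> arr s' a_row u = u * n)) => // j s1 hj fr hu [It I].
have hn1 : var s1 x_n = n by rewrite fr.1.
split; first by rewrite /= /upd /= It hn1 mulSn addnC.
move=> v; rewrite ltnS leq_eqVlt /= /upd hu It.
by case: eqP => [->|_] //=; apply: I.
Qed.

Lemma sem_clear_labels s : input_read s ->
  forall v : 'I_n, arr (sem clear_labels s) a_label v = 0 /\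
                   arr (sem clear_labels s) a_terminal v = 0.
Proof.
move=> hp v; have hn : var s x_n = n by case: hp.
suff h : let s' := sem clear_labels s in forall v, v < var s x_n ->
    arr s' a_label v = 0 /\ arr s' a_terminal v = 0 by apply: h; rewrite hn.
apply: (@for_ind (fun j s' => forall v, v < j ->
    arr s' a_label v = 0 /\ arr s' a_terminal v = 0)) => // j s1 hj fr hu I x.
rewrite ltnS leq_eqVlt /= /upd hu.
by case: eqP => [->|_] //=; apply: I.
Qed.

Lemma sem_label_terminals s : input_read s -> injective term ->
  (forall v : 'I_n, arr s a_label v = 0 /\ arr s a_terminal v = 0) ->
  let s' := sem label_terminals s in
  (forall i, arr s' a_label (term i) = i /\ arr s' a_terminal (term i) = 1) /\
  (forall v, (forall i, v != term i) -> arr s' a_label v = 0 /\ arr s' a_terminal v = 0).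
Proof.
move=> hp inj h0; have hk : var s x_k = k by case: hp.
suff [h1 h2] : let s' := sem label_terminals s in
    (forall i : 'I_k, i < var s x_k ->
       arr s' a_label (term i) = i /\ arr s' a_terminal (term i) = 1) /\
    (forall v, (forall i : 'I_k, v != term i) ->
       arr s' a_label v = 0 /\ arr s' a_terminal v = 0).
  by split=> // i; apply: h1; rewrite hk.
apply: (@for_ind (fun j s' => (forall i : 'I_k, i < j ->
       arr s' a_label (term i) = i /\ arr s' a_terminal (term i) = 1) /\
    (forall v, (forall i : 'I_k, v != term i) ->
       arr s' a_label v = 0 /\ arr s' a_terminal v = 0))).
  by split=> // v _; apply: h0.
move=> j s1 hj fr hu [I1 I2].
rewrite hk in hj; pose x := Ordinal hj.
have hp1 : input_read s1 by apply: input_read_frame fr isT hp.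
have tE : arr s1 a_input (3 + j) = term x by case: hp1 => _ _ <-.
split=> [i|v hv].
  rewrite ltnS leq_eqVlt /= /upd hu tE (inj_eq val_inj) (inj_eq inj) -val_eqE /=.
  by case: (i =P j :> nat) => [->|_] //=; apply: I1.
rewrite /= /upd hu tE (inj_eq val_inj) (negbTE (hv x)).
exact: I2.
Qed.

Lemma sem_set_bound s : input_read s -> rows_set s ->
  var (sem set_bound s) x_bound = (pair_sum w).+1.
Proof.
move=> hp hr; rewrite /set_bound sem_seq; set s0 := sem (Assign _ _) s.
have hp0 : input_read s0 by []. have hr0 : rows_set s0 by [].
have hn : var s0 x_n = n by case: hp.
have -> : pair_sum w = \sum_(u < n | u < var s0 x_n) \sum_v w u v.
  by apply: eq_bigl => u; rewrite hn ltn_ord.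
apply: (@for_ind (fun j s' => var s' x_bound =
  (\sum_(u < n | u < j) \sum_v w u v).+1)) => [|j s1 hj fr hu I].
  by rewrite big_pred0_eq.
rewrite hn in hj; pose u := Ordinal hj.
have hp1 := input_read_frame fr isT hp0.
have hr1 : rows_set s1 by move=> x; rewrite fr.2.
have hn1 : var s1 x_n = n by case: hp1.
rewrite (sum_prefixS _ u).
transitivity (var s1 x_bound + \sum_(v < n | v < var s1 x_n) w u v); last first.
  rewrite I addSn addnC; congr (_ + _).+1.
  by apply: eq_bigl => v; rewrite hn1 ltn_ord.
apply: (@for_ind (fun j s' => var s' x_bound =
  var s1 x_bound + \sum_(v < n | v < j) w u v)) => [|i s2 hi fr2 hv I2].
  by rewrite big_pred0_eq addn0.
rewrite hn1 in hi; pose v := Ordinal hi.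
rewrite (sum_prefixS _ v).
have [_ hk2 _ hw2] := input_read_frame fr2 isT hp1.
have hu2 : var s2 x_u = u by rewrite fr2.1.
have hr2 : arr s2 a_row u = u * n by rewrite fr2.2 ?hr1.
by rewrite /upd /= I2 hk2 hu2 hr2 hv -[i]/(val v) hw2 -addnA [w u v + _]addnC.
Qed.

(** The argument [g] shows that there is a label as soon as there is a vertex, so the number 0
    stored at every vertex that is not a terminal is a label. *)
Lemma sem_preparation s (g : 'I_n -> 'I_k) : input_read s -> injective term ->
  let s' := sem preparation s in
  [/\ prepared s', var s' x_bound = (pair_sum w).+1 &
      exists f, labelled f s' /\ respects term f].
Proof.
move=> hp inj.
have -> : sem preparation s = sem set_bound (sem label_terminals (sem clear_labels
  (sem set_rows s))) by [].
have hr1 := sem_set_rows hp; have hp1 := input_read_frame (frame_sem set_rows s) isT hp.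
move: (sem set_rows s) hr1 hp1 => s1 hr1 hp1.
have h2 := sem_clear_labels hp1; have fr2 := frame_sem clear_labels s1.
have hp2 := input_read_frame fr2 isT hp1.
have hr2 : rows_set (sem clear_labels s1) by move=> u; rewrite fr2.2.
move: (sem clear_labels s1) h2 hp2 hr2 {fr2} => s2 h2 hp2 hr2.
have [h3 h3'] := sem_label_terminals hp2 inj h2; have fr3 := frame_sem label_terminals s2.
have hp3 := input_read_frame fr3 isT hp2.
have hr3 : rows_set (sem label_terminals s2) by move=> u; rewrite fr3.2.
move: (sem label_terminals s2) h3 h3' hp3 hr3 {fr3} => s3 h3 h3' hp3 hr3 /=.
have h4 := sem_set_bound hp3 hr3; have fr4 := frame_sem set_bound s3.
have hp4 := input_read_frame fr4 isT hp3.
have hr4 : rows_set (sem set_bound s3) by move=> u; rewrite fr4.2.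
have lab : arr (sem set_bound s3) a_label = arr s3 a_label by rewrite fr4.2.
have ter : arr (sem set_bound s3) a_terminal = arr s3 a_terminal by rewrite fr4.2.
have cases v : (exists i, v = term i) \/ (forall i, v != term i).
  case: (boolP [exists i, v == term i]) => [/existsP[i /eqP ->]|]; first by left; exists i.
  by rewrite negb_exists => /forallP; right.
split=> //.
- split=> // v; rewrite ter; apply/idP/existsP => [nz|[i /eqP ->]]; last by have [_ ->] := h3 i.
  case: (cases v) => [[i ->]|hv]; first by exists i.
  by have [_ z] := h3' v hv; rewrite z in nz.
- pose f v : 'I_k := insubd (g v) (arr s3 a_label v).
  have lf v : f v = arr s3 a_label v :> nat.
    rewrite val_insubd; case: ifP => // /negbT; rewrite -leqNgt.
    case: (cases v) => [[i ->]|hv]; first by have [-> _] := h3 i; rewrite leqNgt ltn_ord.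
    by have [-> _] := h3' v hv; rewrite leqNgt (leq_ltn_trans _ (ltn_ord (g v))).
  exists f; split=> [v|i]; first by rewrite lab lf.
  by apply: val_inj; rewrite /= lf; have [] := h3 i.
Qed.

Lemma sem_write_output s f : prepared s -> labelled f s ->
  let s' := sem write_output s in
  [/\ var s' x_n = n, arr s' a_output n = n &
      forall v : 'I_n, arr s' a_output (n + v.+1) = f v].
Proof.
move=> hp hl; rewrite /write_output sem_seq.
have hn : var s x_n = n by case: hp => -[].
have -> : sem (Put a_output (Var x_n) (Var x_n)) s = seta s a_output n n by rewrite /= hn.
set s1 := seta _ _ _ _; have hn1 : var s1 x_n = n by [].
set c := For _ _ _.
suff [h1 h2] : let s' := sem c s1 in arr s' a_output n = n /\
    forall v : 'I_n, v < var s1 x_n -> arr s' a_output (n + v.+1) = f v.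
  split=> //; first by rewrite (frame_sem c s1).1.
  by move=> v; apply: h2; rewrite hn1.
apply: (@for_ind (fun j s' => arr s' a_output n = n /\
    forall v : 'I_n, v < j -> arr s' a_output (n + v.+1) = f v)).
  by split=> //; rewrite /= /upd eqxx.
move=> j s2 hj fr hv [I1 I2]; rewrite hn1 in hj; pose x := Ordinal hj.
have hn2 : var s2 x_n = n by rewrite fr.1.
have hl2 : arr s2 a_label j = f x by rewrite fr.2 //; apply: (hl x).
split; first by rewrite /= /upd hn2 hv; case: eqP => // ?; lia.
move=> v; rewrite ltnS leq_eqVlt /= /upd hn2 hv hl2 -addnA add1n eqn_add2l eqSS.
case: (v =P j :> nat) => [vj _|_]; last exact: I2.
by congr (val (f _)); apply: val_inj.
Qed.

End Verification.

(** * Multiway cuts as labellings *)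

Lemma nth_allpairs (S T R : Type) (g : S -> T -> R) x0 y0 z0 s t i j :
  i < size s -> j < size t ->
  nth z0 [seq g x y | x <- s, y <- t] (i * size t + j) = g (nth x0 s i) (nth y0 t j).
Proof.
elim: s i => //= x s ih [|i] hi hj; rewrite nth_cat size_map.
  by rewrite hj (nth_map y0).
by rewrite mulSn -addnA ltnNge leq_addr /= addKn ih.
Qed.

Section Instance.
Variables (n k : nat) (G : instance int 'I_n k).
Local Open Scope nat_scope.

Definition edge_weight (u v : 'I_n) : nat :=
  if [set u; v] \in edges G then `|weight G [set u; v]|%N else 0.

Lemma edge_weight_sym u v : edge_weight u v = edge_weight v u.
Proof. by rewrite /edge_weight setUC. Qed.

Lemma size_encode_instance : size (encode_instance G) = 2 + k + n * n.
Proof. by rewrite /= size_cat size_map size_allpairs !size_enum_ord. Qed.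

Lemma nth_encode_terminal (i : 'I_k) :
  nth 0 (encode_instance G) (2 + i) = terminal G i.
Proof.
rewrite /= add0n nth_cat size_map size_enum_ord ltn_ord.
by rewrite (nth_map i) ?size_enum_ord // nth_ord_enum.
Qed.

Lemma nth_encode_weight (u v : 'I_n) :
  nth 0 (encode_instance G) (2 + k + (u * n + v)) = edge_weight u v.
Proof.
rewrite /= add0n nth_cat size_map size_enum_ord ltnNge leq_addr /= addKn.
have := @nth_allpairs _ _ _ edge_weight u v 0 (enum 'I_n) (enum 'I_n) u v.
by rewrite !size_enum_ord !nth_ord_enum => ->.
Qed.

Definition cut_of (f : 'I_n -> 'I_k) : {ffun 'I_k -> {set 'I_n}} :=
  [ffun i => [set v | f v == i]].

Lemma nth_encode_cut f (v : 'I_n) : nth 0 (encode_cut (cut_of f)) v = f v.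
Proof.
rewrite (nth_map v) ?size_enum_ord // nth_ord_enum.
rewrite (@eq_find _ _ (pred1 (f v))) => [|i]; first exact: index_enum_ord.
by rewrite ffunE inE /= eq_sym.
Qed.

Lemma multiway_cut_of f : respects (terminal G) f -> multiway_cut G (cut_of f).
Proof.
move=> hf; apply/and3P; split.
- by apply/forallP => i; rewrite ffunE inE hf.
- apply/forallP => i; apply/forallP => j; apply/implyP => ij.
  rewrite -setI_eq0; apply/eqP/setP => v; rewrite !ffunE !inE.
  by apply/negbTE; apply: contra ij => /andP[/eqP <- /eqP <-].
- by apply/eqP/setP => v; rewrite inE; apply/bigcupP; exists (f v); rewrite ?ffunE ?inE.
Qed.

Lemma multiway_cut_labelling S : multiway_cut G S ->
  exists2 f, respects (terminal G) f & S = cut_of f.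
Proof.
move=> /and3P[/forallP ht /forallP hd /eqP hc].
have ex v : exists i, v \in S i.
  have : v \in \bigcup_i S i by rewrite hc inE.
  by case/bigcupP => i _; exists i.
have uniq_part i j v : v \in S i -> v \in S j -> i = j.
  move=> vi vj; apply/eqP; have /forallP/(_ j) := hd i.
  apply: contraTT => ij; rewrite negb_imply ij /=.
  by apply/pred0Pn; exists v; rewrite /= vi.
exists (fun v => xchoose (ex v)) => [i|].
  exact: uniq_part (xchooseP (ex _)) (ht i).
apply/ffunP => i; rewrite ffunE; apply/setP => v; rewrite inE.
by apply/idP/eqP => [vi|<-]; [apply: uniq_part (xchooseP (ex v)) vi | exact: (xchooseP (ex v))].
Qed.

Lemma cut_edges_of f u v :
  ([set u; v] \in cut_edges G (cut_of f)) = ([set u; v] \in edges G) && (f u != f v).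
Proof.
rewrite inE; congr (_ && _); apply/existsP/idP => [[i /existsP[j /and3P[ij]]]|fuv].
  rewrite !ffunE => /set0Pn[x /setIP[]]; rewrite !inE => hx /eqP xi.
  move=> /set0Pn[y /setIP[]]; rewrite !inE => hy /eqP yj.
  by apply: contraNneq ij => e; rewrite -xi -yj; case/orP: hx => /eqP ->;
    case/orP: hy => /eqP ->; rewrite ?e.
exists (f u); apply/existsP; exists (f v); rewrite fuv !ffunE /=.
by apply/andP; split; apply/set0Pn; [exists u|exists v]; rewrite !inE !eqxx ?orbT.
Qed.

(** Ordered pairs are grouped by the set they form. The fibre over an edge consists of its two
    orientations, because an edge has exactly two elements; this is the factor 2. *)
Lemma total_weight_pairs (A : {set {set 'I_n}}) : A \subset edges G ->
  ((pair_sum (fun u v => (([set u; v] \in A) * edge_weight u v)%N))%:Z =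
   2 * total_weight G A)%R.
Proof.
move=> sA.
have -> : pair_sum (fun u v => ([set u; v] \in A) * edge_weight u v) =
    \sum_(e in A) 2 * `|weight G e|%N.
  rewrite /pair_sum pair_big /= (bigID (fun p => [set p.1; p.2] \in A)) /=.
  rewrite [X in _ + X]big1 ?addn0 => [|p /negbTE ->]; last by rewrite mul0n.
  rewrite (partition_big (fun p => [set p.1; p.2]) (mem A)) //=.
  apply: eq_bigr => e eA.
  rewrite (eq_bigr (fun=> `|weight G e|%N)) => [|p /andP[pA /eqP pe]]; last first.
    by rewrite /edge_weight pe eA mul1n (subsetP sA).
  rewrite sum_nat_const; congr (_ * _).
  have e2 := edges_card (subsetP sA e eA).
  have /cards2P[x [y [xy exy]]] : #|e| == 2 by rewrite e2.
  subst e.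
  transitivity #|[set (x, y); (y, x)]|; last first.
    by rewrite cards2 xpair_eqE negb_and xy.
  apply: eq_card => -[u v]; rewrite !inE /= !xpair_eqE.
  apply/andP/orP => [[_ /eqP euv]|].
    have uv : u != v by move: e2; rewrite -euv cards2; case: (u != v).
    have : u \in [set x; y] by rewrite -euv !inE eqxx.
    have : v \in [set x; y] by rewrite -euv !inE eqxx orbT.
    by move=> /set2P[] hv /set2P[] hu; subst u v; rewrite ?eqxx in uv *; auto.
  by case=> /andP[/eqP -> /eqP ->]; rewrite ?(setUC [set y]) eA eqxx.
rewrite (big_morph Posz PoszD (erefl _)) /total_weight mulr_sumr.
apply: eq_bigr => e eA; rewrite PoszM gez0_abs // ltW // weight_gt0 //.
exact: subsetP sA _ eA.
Qed.

Lemma cut_edges_sub S : cut_edges G S \subset edges G.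
Proof. by apply/subsetP => e; rewrite inE => /andP[]. Qed.

Lemma total_weight_separated f g :
  ((separated_only edge_weight f g)%:Z =
   2 * total_weight G (cut_edges G (cut_of f) :\: cut_edges G (cut_of g)))%R.
Proof.
rewrite -total_weight_pairs; last exact: subset_trans (subsetDl _ _) (cut_edges_sub _).
congr Posz; apply: eq_pair_sum => u v; rewrite in_setD !cut_edges_of /edge_weight.
case: ifP => uvE; last by rewrite !muln0.
by rewrite /= negbK andbC.
Qed.

(** Outside [N], stability would make the weight cut by [f] only exceed four times the weight cut by
    [g] only, while local optimality allows at most twice. The strict inequality also settles the
    case where the latter weight is 0. *)
Lemma locally_optimal_in_N (N : {set {ffun 'I_k -> {set 'I_n}}}) f :
  weakly_stable G 4%:R N -> respects (terminal G) f ->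
  locally_optimal edge_weight (terminal G) f -> cut_of f \in N.
Proof.
move=> [_ [Sopt [[hS _] _ stable]]] hf opt.
apply/negPn/negP => notin; have := stable _ (multiway_cut_of hf) notin.
have [g hg ->] := multiway_cut_labelling hS.
have := locally_optimal_le hf hg opt.
have := total_weight_separated f g; have := total_weight_separated g f.
lia.
Qed.

End Instance.

(** * Polynomial bounds and the theorem *)

Lemma nat_horner_le (p : {poly nat}) (a b : nat) : a <= b -> (p.[a])%R <= (p.[b])%R.
Proof.
move=> ab; elim/poly_ind: p => [|p c ih]; first by rewrite !horner0.
by rewrite !hornerMXaddC; apply: leq_add => //; apply: leq_mul.
Qed.

Lemma size_le_bitsize x : size x <= bitsize x.
Proof. by rewrite -sum1_size; apply: leq_sum. Qed.

Lemma sum_edge_weight n k (G : instance int 'I_n k) m :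
  (forall e, e \in edges G -> (1 <= weight G e <= m%:Z)%R) ->
  pair_sum (edge_weight G) <= n * n * m.
Proof.
move=> hw; have -> : n * n * m = pair_sum (fun _ _ : 'I_n => m).
  by rewrite /pair_sum !sum_nat_const !card_ord mulnA.
apply: leq_pair_sum => u v; rewrite /edge_weight.
by case: ifP => // /hw; lia.
Qed.

Lemma labelling_cost_le n k (w : 'I_n -> 'I_n -> nat) (f : 'I_n -> 'I_k) :
  labelling_cost w f <= pair_sum w.
Proof. by apply: leq_pair_sum => u v; case: (f u != f v); rewrite ?mul1n. Qed.

Lemma multiway_cut_program_correct n k (G : instance int 'I_n k) N B s :
  weakly_stable G 4%:R%R N -> n <= B -> k <= B -> pair_sum (edge_weight G) < B ->
  reads_input (encode_instance G) s ->
  exists y, [/\ (exists2 S, S \in N & y = encode_cut S), size y = n,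
    cost multiway_cut_program s <=
      20 + (time_bound preparation B + time_bound (Seq local_search write_output) B),
    var (sem multiway_cut_program s) 5 = n &
    forall i, i <= n -> arr (sem multiway_cut_program s) 7 (n + i) = nth 0 (n :: y) i].
Proof.
move=> stable nB kB WB hin.
have szx := size_encode_instance G.
have hn : arr s 0 1 = n by rewrite hin ?szx.
have hk : arr s 0 2 = k by rewrite hin ?szx.
(* Stability supplies a multiway cut, hence a labelling; this rules out vertices without any
   label. *)
have [g0 _] : exists g, respects (terminal G) g.
  case: stable => _ [S [[hS _] _ _]].
  by have [g] := multiway_cut_labelling hS; exists g.
have hp1 : input_read (edge_weight G) (terminal G) (sem read_sizes s).
  split=> [||i|u v]; [by []|by []| |].
    by rewrite [LHS]hin ?szx -?nth_encode_terminal //; have := ltn_ord i; lia.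
  rewrite [LHS]hin ?szx -?nth_encode_weight //.
  have := ltn_ord v; have := ltn_ord u; nia.
(* [read_sizes] writes the variables that bound the later loops; having no loop itself, it has a
   constant cost that is found by computation. *)
have fr1 : cost read_sizes s <= 20 by [].
have eq_run : sem multiway_cut_program s =
    sem write_output (sem local_search (sem preparation (sem read_sizes s))) by [].
have eq_cost : cost multiway_cut_program s = cost read_sizes s +
    (cost preparation (sem read_sizes s) +
     cost (Seq local_search write_output) (sem preparation (sem read_sizes s))) by [].
have c2 : cost preparation (sem read_sizes s) <= time_bound preparation B.
  apply: (@cost_le [:: 5; 6]) => // x; rewrite !inE.
  by case: hp1 => h5 h6 _ _ /orP[] /eqP ->; rewrite ?h5 ?h6.
have [hp2 hb2 [f [hl2 hf]]] := sem_preparation g0 hp1 (@terminal_inj _ _ _ G).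
rewrite {}eq_run {}eq_cost.
move: (sem preparation _) c2 hp2 hb2 hl2 => s2 c2 hp2 hb2 hl2.
(* Variable 7, the iteration bound, is written by [preparation] and is read-only only from here on,
   hence two separate estimates. *)
have c3 : cost (Seq local_search write_output) s2 <=
    time_bound (Seq local_search write_output) B.
  apply: (@cost_le [:: 5; 6; 7]) => // x; rewrite !inE.
  by case: hp2 => -[h5 h6 _ _] _ _ /or3P[] /eqP ->; rewrite ?h5 ?h6 ?hb2.
have bound (g : 'I_n -> 'I_k) : labelling_cost (edge_weight G) g < var s2 7.
  by rewrite hb2 ltnS labelling_cost_le.
have [h [hl3 hh opt]] := sem_local_search (edge_weight_sym G) hp2 hl2 hf bound.
have hp3 := prepared_frame (frame_sem local_search s2) isT hp2.
have [h5 hout houts] := sem_write_output hp3 hl3.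
exists (encode_cut (cut_of h)); split=> //.
- by exists (cut_of h); [apply: (locally_optimal_in_N stable hh opt)|].
- by rewrite size_map size_enum_ord.
- exact: leq_add fr1 (leq_add c2 c3).
- move=> [|i] hi; first by rewrite addn0 hout.
  by rewrite (houts (Ordinal hi)) /= (nth_encode_cut h (Ordinal hi)).
Qed.

Local Open Scope ring_scope.

Theorem theorem6 :
  exists P : program,
  forall p : {poly nat},
  exists q : {poly nat},
  forall (n k : nat) (G : instance int 'I_n k)
         (N : {set {ffun 'I_k -> {set 'I_n}}}),
    (forall e, e \in edges G -> 1 <= weight G e <= (p.[n])%:Z) ->
    weakly_stable G 4%:R N ->
    exists2 S, S \in N &
      computes_within P (encode_instance G)
        (q.[bitsize (encode_instance G)]) (encode_cut S).
Proof.
exists (compile multiway_cut_program) => p.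
(* At the bit size [b] this bounds [n] and [k], and strictly exceeds the sum of the matrix entries,
   which is at most [n * n * p.[n]]. *)
pose B : {poly nat} := 'X + 1 + 'X * 'X * p.
have qE (u v : {poly nat}) a :
    (120%N%:P + (u + v) + 32%N%:P * 'X).[a] = (120 + (u.[a] + v.[a]) + 32 * a)%N.
  by rewrite !hornerE.
(* 120 is the 20 for [read_sizes] plus the 100 of [compile_correct]; 32 is twice 16, because [b]
   bounds both the input length and [n]. *)
exists (120%N%:P + (time_bound preparation B +
        time_bound (Seq local_search write_output) B) + 32%N%:P * 'X) => n k G N hw stable.
set x := encode_instance G; set b := bitsize x.
have szx := size_encode_instance G; rewrite -/x in szx.
have szb : (size x <= b)%N := size_le_bitsize x.
have nb : (n <= b)%N by nia.
have kb : (k <= b)%N by nia.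
pose Bb : nat := B.[b].
have BbE : Bb = (b + 1 + b * b * p.[b])%N by rewrite /Bb /B !hornerE.
have WB : (pair_sum (edge_weight G) < Bb)%N.
  have := sum_edge_weight hw; have le_p := nat_horner_le p nb.
  rewrite BbE addn1 addSn ltnS => /leq_trans -> //.
  by apply: leq_trans (leq_addl _ _); rewrite !leq_mul.
have [||_ [S SN ->] hS] := @compile_correct multiway_cut_program x
  (fun y => exists2 S, S \in N & y = encode_cut S) n
  (20 + (time_bound preparation Bb + time_bound (Seq local_search write_output) Bb))
  (120 + (time_bound preparation Bb + time_bound (Seq local_search write_output) Bb) + 32 * b)
  wf_multiway_cut_program ltac:(lia).
- by move=> s; apply: multiway_cut_program_correct stable _ _ WB; rewrite BbE; lia.
- by lia.
by exists S => //; rewrite qE !horner_time_bound.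
Qed.
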